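(* Let $r\geq 1$ be an integer and let $H$ be a fixed graph with chromatic number $\chi(H)=r+1$. Then there is a constant $C=C(H)$ such that for every $\varepsilon>0$ there exists $n_0$ with the following property. Whenever $n\geq n_0$ and $G$ is an $n$-vertex graph with minimum degree \[\delta(G)>\left(1-\frac{3}{3r-1}+\varepsilon\right)n\] which does not contain $H$ as a subgraph, one can delete at most $C\,\mathrm{biex}(n,H)$ edges from $G$ to obtain an $r$-partite graph.
   Context: For a graph $H$ with chromatic number $\chi(H)$, consider every proper colouring $c:V(H)\to\{1,\dots,\chi(H)\}$ of $H$ with $\chi(H)$ colours, and let $S_c=c^{-1}(\{1,2\})$ be the set of vertices receiving colours $1$ or $2$. Let $\mathcal{F}$ be the family of all graphs $H[S_c]$ (the subgraph of $H$ induced by $S_c$) over all such colourings $c$. Then $\mathrm{biex}(n,H)$ is defined to be $\mathrm{ex}(n,\mathcal{F})$, the maximum number of edges in an $n$-vertex graph containing no subgraph isomorphic to any member of $\mathcal{F}$. A graph is $r$-partite if its vertex set can be partitioned into $r$ independent sets. *)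

(* Defs.v *)
From HB Require Import structures.
From mathcomp Require Import all_boot all_order all_algebra reals.

Set Implicit Arguments.
Unset Strict Implicit.
Unset Printing Implicit Defensive.

(* A finite simple graph on the vertex type V, given by its set of edges; it is
   a subtype of {set {set V}}, so the graphs on V themselves form a finType. *)
Definition simple_edges (V : finType) (E : {set {set V}}) : bool :=
  [forall e in E, #|e| == 2].

Record sgraph (V : finType) := SGraph {
  edges : {set {set V}};
  edgesP : simple_edges edges }.

HB.instance Definition _ (V : finType) := [isSub for @edges V].
HB.instance Definition _ (V : finType) := [Finite of sgraph V by <:].

(* [set x; x] is a singleton, hence never an edge: adj is irreflexive. *)
Definition adj (V : finType) (G : sgraph V) : rel V :=
  fun x y => [set x; y] \in edges G.

Definition degree (V : finType) (G : sgraph V) (x : V) : nat :=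
  #|[set y | adj G x y]|.

(* The default value #|V| exceeds every degree, so it only matters when V is
   empty. *)
Definition min_degree (V : finType) (G : sgraph V) : nat :=
  \big[minn/#|V|]_(x : V) degree G x.

(* G has a (not necessarily induced) subgraph isomorphic to H. *)
Definition contains (U V : finType) (G : sgraph V) (H : sgraph U) : bool :=
  [exists f : {ffun U -> V},
    injectiveb f && [forall x, forall y, adj H x y ==> adj G (f x) (f y)]].

Definition independent (V : finType) (G : sgraph V) (A : {set V}) : bool :=
  [forall x in A, forall y in A, ~~ adj G x y].

(* The r parts are the fibres of f; empty parts are allowed. *)
Definition partite (V : finType) (r : nat) (G : sgraph V) : bool :=
  [exists f : {ffun V -> 'I_r}, forall i, independent G (f @^-1: [set i])].

Definition proper_colouring (V : finType) (G : sgraph V) (k : nat)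
    (c : {ffun V -> 'I_k}) : bool :=
  [forall x, forall y, adj G x y ==> (c x != c y)].

Definition colourable (V : finType) (G : sgraph V) (k : nat) : bool :=
  [exists c : {ffun V -> 'I_k}, proper_colouring G c].

Lemma colourable_ex (V : finType) (G : sgraph V) : exists k, colourable G k.
Proof.
exists #|V|; apply/existsP; exists [ffun x => enum_rank x].
apply/forallP => x; apply/forallP => y; apply/implyP => xy.
rewrite !ffunE (inj_eq enum_rank_inj); apply/eqP => exy.
have /forall_inP/(_ _ xy) := edgesP G.
by rewrite exy setUid cards1.
Qed.

Definition chromatic_number (V : finType) (G : sgraph V) : nat :=
  ex_minn (colourable_ex G).

Lemma induced_proof (V : finType) (G : sgraph V) (S : {set V}) :
  simple_edges [set e : {set {x : V | x \in S}} | [set val x | x in e] \in edges G].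
Proof.
apply/forall_inP => e; rewrite inE => He.
have /forall_inP/(_ _ He) := edgesP G.
by rewrite card_imset //; exact: val_inj.
Qed.

Definition induced (V : finType) (G : sgraph V) (S : {set V}) :
  sgraph {x : V | x \in S} := SGraph (induced_proof G S).

Lemma delete_edges_proof (V : finType) (G : sgraph V) (D : {set {set V}}) :
  simple_edges (edges G :\: D).
Proof.
apply/forall_inP => e /setDP[He _].
by have /forall_inP/(_ _ He) := edgesP G.
Qed.

Definition delete_edges (V : finType) (G : sgraph V) (D : {set {set V}}) :
  sgraph V := SGraph (delete_edges_proof G D).

Definition graph_family := seq {V : finType & sgraph V}.

Definition family_free (V : finType) (G : sgraph V) (F : graph_family) : bool :=
  all (fun A => ~~ contains G (projT2 A)) F.

(* The maximum is 0 if no graph on n vertices is F-free, which cannot happen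
   when every member of F has an edge. *)
Definition ex (n : nat) (F : graph_family) : nat :=
  \max_(G : sgraph 'I_n | family_free G F) #|edges G|.

(* Colours are numbered from 0, so colours 1 and 2 are the ordinals 0 and 1. *)
Definition two_colour_set (V : finType) (k : nat) (c : {ffun V -> 'I_k}) :
  {set V} := [set x | c x < 2].

Definition bichromatic_family (V : finType) (H : sgraph V) : graph_family :=
  [seq existT (fun U : finType => sgraph U) _ (induced H (two_colour_set c))
     | c <- enum [set c : {ffun V -> 'I_(chromatic_number H)}
                     | proper_colouring H c]].

Definition biex (n : nat) (V : finType) (H : sgraph V) : nat :=
  ex n (bichromatic_family H).

(* Main.v *)
(* By the box lemma, a graph G without H has few copies of K_(r+1), so that a
   random sample of boundedly many vertices of G is K_(r+1)-free and still satisfies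
   the minimum degree condition; by the Andrasfai-Erdos-Sos theorem the sample is
   r-colourable.  Its colouring is essentially unique, and it extends to almost all
   vertices of G, so that a maximum r-cut of G misses only a small proportion of the
   pairs.  In such a cut the degree condition leaves a positive density of cliques in
   the common neighbourhood of two vertices of the same class, and of r-cliques in the
   neighbourhood of a vertex with many neighbours in its own class; both densities are
   bounded below independently of eps.  Averaging over blown-up (r-1)-cliques finds
   one joined to both ends of a positive proportion of the remaining edges inside a
   class, and these edges span a graph without members of the bichromatic family.
   The vertices with many neighbours in their own class have boundedly many such
   neighbours in units of n, and they can only exist if biex(n, H) >= n - 1, since
   otherwise some member of the family is contained in a star. *)

Require Import Defs.
From mathcomp Require Import all_boot all_order all_algebra reals.
From mathcomp Require Import boolp zify ring lra.
Import Order.TTheory GRing.Theory Num.Theory.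
Local Open Scope ring_scope.

Set Implicit Arguments.
Unset Strict Implicit.
Unset Printing Implicit Defensive.

(** * Iterated averages *)

(** Put [q = 1 / (3 r - 1)]. Every vertex misses at most [3 q - eps] of the vertices, and a typical
    vertex misses nearly all of its own class, so each of the [r] classes has density at most about
    [3 q]. Since [3 r q = 1 + q], the classes fall short of [3 q] by about [q] in total. This single
    budget controls all greedy constructions of cliques and yields the densities [(q / 16) ^ r] and
    [(q / 4) ^ r], which do not involve [eps]. The obstacle is that [C] is fixed before [eps]. The
    available bound on the number of vertices with many neighbours in their own class depends on
    [eps]; only the sum of their own-class densities is bounded independently of it. Hence the
    clique density in the neighbourhood of such a vertex is shown to be proportional to its
    own-class density [d]. All counts are normalised averages over sequences with repetition, so
    [#|V|] enters essentially only through the loss of order [1 / #|V|] from repeated entries and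
    through [n - 1 <= biex]. *)

Section Averaging.
Variable R : realType.

(** An abstract expectation. The domain [D] limits where monotonicity is tested: an iterated average
    is a functional on all sequences but only sees those of one length. *)
Record averaging (T : Type) (D : T -> Prop) (A : (T -> R) -> R) : Prop :=
  Averaging {
    averagingD : forall F G, A (fun x => F x + G x) = A F + A G;
    averagingZ : forall c F, A (fun x => c * F x) = c * A F;
    averaging1 : A (fun=> 1) = 1;
    averaging_le : forall F G, (forall x, D x -> F x <= G x) -> A F <= A G }.

Section AveragingTheory.
Variables (T : Type) (D : T -> Prop) (A : (T -> R) -> R).
Hypothesis avA : averaging D A.

Lemma averaging_const c : A (fun=> c) = c.
Proof.
transitivity (A (fun=> c * 1)); first by rewrite mulr1.
by rewrite (averagingZ avA c (fun=> 1)) (averaging1 avA) mulr1.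
Qed.

Lemma averaging_ge0 F : (forall x, D x -> 0 <= F x) -> 0 <= A F.
Proof. by move=> F0; rewrite -(averaging_const 0); apply: (averaging_le avA). Qed.

Lemma averaging_witness c F : c < A F -> exists2 x, D x & c < F x.
Proof.
move=> cA; apply: contrapT => nex.
have : A F <= c.
  rewrite -[leRHS]averaging_const; apply: (averaging_le avA) => x Dx.
  by rewrite leNgt; apply/negP => cF; apply: nex; exists x.
by rewrite leNgt cA.
Qed.

Lemma averaging_sum (I : Type) (r : seq I) (P : pred I) (F : I -> T -> R) :
  A (fun x => \sum_(i <- r | P i) F i x) = \sum_(i <- r | P i) A (F i).
Proof.
elim: r => [|i r IH]; first by under eq_fun do rewrite big_nil; rewrite averaging_const big_nil.
rewrite big_cons -IH; case: (boolP (P i)) => Pi.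
  by under eq_fun do rewrite big_cons Pi; rewrite (averagingD avA).
by under eq_fun do rewrite big_cons (negPf Pi).
Qed.

Lemma averagingB F G : A (fun x => F x - G x) = A F - A G.
Proof.
rewrite (averagingD avA) -[- A G]mulN1r -(averagingZ avA).
by congr (_ + A _); apply/funext => x; rewrite mulN1r.
Qed.

End AveragingTheory.

(* The tangent line of [x ^+ p.+1] at [a], multiplied out. *)
Lemma exprS_tangent (p : nat) (a x : R) : 0 <= a -> 0 <= x ->
  p.+1%:R * a ^+ p * x <= x ^+ p.+1 + p%:R * a ^+ p.+1.
Proof.
move=> a0 x0; elim: p => [|p IH]; first by rewrite !expr0 !expr1 !mul1r mul0r addr0.
have h : 0 <= p.+1%:R * a ^+ p * (x - a) ^+ 2.
  by rewrite mulr_ge0 ?sqr_ge0 // mulr_ge0 ?exprn_ge0.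
have := ler_wpM2r x0 IH.
rewrite !exprSr in h *.
rewrite -!natr1 in h *; move: (a ^+ p) (x ^+ p) h => ap xp; move: (p%:R : R) => P.
by nra.
Qed.

(** Jensen's inequality from the tangent line at [A F]: linearity, monotonicity and normalisation
    suffice, so it also serves iterated averages. *)
Lemma averaging_power_mean (T : Type) (D : T -> Prop) A (p : nat) (F : T -> R) :
  averaging D A -> (forall x, D x -> 0 <= F x) -> A F ^+ p <= A (fun x => F x ^+ p).
Proof.
move=> avA F0; case: p => [|p].
  by rewrite expr0; under eq_fun do rewrite expr0; rewrite (averaging1 avA).
have a0 : 0 <= A F by apply: averaging_ge0 F0.
have : A (fun x => p.+1%:R * A F ^+ p * F x - p%:R * A F ^+ p.+1)
       <= A (fun x => F x ^+ p.+1).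
  apply: (averaging_le avA) => x Dx.
  by rewrite lerBlDr; apply: exprS_tangent => //; apply: F0.
rewrite (averagingB avA) (averagingZ avA) (averaging_const avA).
by rewrite !exprSr -natr1; set a := A F; set b := a ^+ p; lra.
Qed.

Definition avg (V : finType) (F : V -> R) : R := (\sum_x F x) / #|V|%:R.

Lemma avg_averaging (V : finType) :
  (0 < #|V|)%N -> averaging (fun _ : V => True) (@avg V).
Proof.
move=> V0; have V0' : 0 < #|V|%:R :> R by rewrite ltr0n.
split=> [F G|c F||F G FG]; rewrite /avg.
- by rewrite big_split mulrDl.
- by rewrite -mulr_sumr mulrA.
- by rewrite sumr_const divff // gt_eqF.
- by apply: ler_wpM2r; [rewrite invr_ge0 ltW | apply: ler_sum => x _; apply: FG].
Qed.

Fixpoint iavg (T : Type) (A : (T -> R) -> R) (k : nat) (F : seq T -> R) : R :=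
  if k is k'.+1 then A (fun x => iavg A k' (fun s => F (x :: s))) else F [::].

Definition all_size (T : Type) (D : T -> Prop) (k : nat) (s : seq T) : Prop :=
  size s = k /\ foldr (fun x P => D x /\ P) True s.

Lemma iavg_averaging (T : Type) (D : T -> Prop) A k :
  averaging D A -> averaging (all_size D k) (iavg A k).
Proof.
move=> avA; elim: k => [|k IH]; split=> //=.
- by move=> F G FG; apply: FG.
- move=> F G; rewrite -(averagingD avA); congr A; apply/funext => x.
  by rewrite -(averagingD IH).
- move=> c F; rewrite -(averagingZ avA); congr A; apply/funext => x.
  by rewrite -(averagingZ IH).
- by under eq_fun do rewrite (averaging1 IH); rewrite (averaging1 avA).
- move=> F G FG; apply: (averaging_le avA) => x Dx; apply: (averaging_le IH) => s [ss Ds].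
  by apply: FG; split=> //=; rewrite ss.
Qed.

Lemma iavg_avg_comm (V W : finType) (A := @avg V) k (F : W -> seq V -> R) :
  avg (fun w => iavg A k (F w)) = iavg A k (fun s => avg (fun w => F w s)).
Proof.
rewrite /A; elim: k F => [//|k IH] F /=.
transitivity (avg (fun x => avg (fun w => iavg (@avg V) k (fun s => F w (x :: s))))).
  rewrite /avg -!mulr_suml exchange_big /= -!mulrA; congr (_ * _).
  by rewrite mulrC.
by congr avg; apply/funext => x; rewrite IH.
Qed.

End Averaging.

(** * Boxes *)

Section Box.
Variables (R : realType) (V : finType).
Hypothesis V0 : (0 < #|V|)%N.
Local Notation E := (iavg (@avg R V)).
Let avE k := iavg_averaging k (avg_averaging R V0).

(** For [P := pairwise e] the lists are the parts of a blown-up clique. *)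
Fixpoint box (T : Type) (P : seq T -> bool) (Ts : seq (seq T)) : bool :=
  if Ts is A :: Ts' then all (fun x => box (fun s => P (x :: s)) Ts') A
  else P [::].

Lemma box_all (T S : Type) (P : S -> seq T -> bool) (A : seq S) Ts :
  box (fun s => all (fun x => P x s) A) Ts = all (fun x => box (P x) Ts) A.
Proof.
elim: Ts P => [//|B Ts IH] P /=.
under eq_all do rewrite IH.
by have := allrelC (fun y x => box (fun s => P x (y :: s)) Ts) B A; rewrite /allrel.
Qed.

Lemma boxP (T : eqType) (P : seq T -> bool) Ts x0 s :
  box P Ts -> size s = size Ts ->
  (forall i, (i < size Ts)%N -> nth x0 s i \in nth [::] Ts i) -> P s.
Proof.
elim: Ts P s => [|A Ts IH] P [|x s] //= /allP bP [ss] mem.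
by apply: IH (bP x (mem 0 isT)) ss _ => i; apply: (mem i.+1).
Qed.

Lemma iavg_comm (W : finType) k l (F : seq W -> seq V -> R) :
  iavg (@avg R W) k (fun s => E l (F s)) = E l (fun t => iavg (@avg R W) k (fun s => F s t)).
Proof.
elim: k F => [//|k IH] F /=; rewrite -iavg_avg_comm.
by congr avg; apply/funext => x; rewrite IH.
Qed.

Lemma iavg_prod (T : Type) (D : T -> Prop) A k (f : T -> R) : averaging D A ->
  iavg A k (fun s => \prod_(x <- s) f x) = A f ^+ k.
Proof.
move=> avA; elim: k => [|k IH] /=; first by rewrite big_nil.
under eq_fun => x do under eq_fun do rewrite big_cons.
transitivity (A (fun x => A f ^+ k * f x)).
  by congr A; apply/funext => x; rewrite (averagingZ (iavg_averaging k avA)) IH mulrC.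
by rewrite (averagingZ avA) exprSr.
Qed.

Lemma natr_all (T : Type) (P : pred T) s :
  (all P s)%:R = \prod_(x <- s) (P x)%:R :> R.
Proof.
by elim: s => [|x s IH]; rewrite ?big_nil // big_cons -IH /= -natrM mulnb.
Qed.

(* Two applications of the power mean inequality per coordinate, so that no
   lower bound on #|V| is needed. *)
Lemma box_density k t (P : seq V -> bool) :
  E k (fun s => (P s)%:R) ^+ (t ^ k) <= iavg (E t) k (fun Ts => (box P Ts)%:R).
Proof.
elim: k P => [|k IH] P; first by rewrite expn0 expr1.
rewrite /= iavg_avg_comm expnS exprM.
set h := fun s => avg (fun x => (P (x :: s))%:R) : R.
have h0 s : 0 <= h s by apply: (averaging_ge0 (avg_averaging R V0)).
pose g A := E k (fun s => (all (fun x => P (x :: s)) A)%:R).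
(* First power mean, over the [k] later coordinates: [h s ^+ t] is the density of the [t]-tuples of
   first entries that all suit the same [s]. *)
have hg : E k h ^+ t <= E t g.
  apply: le_trans (averaging_power_mean t (avE k) _) _; first by move=> s _; exact: h0.
  rewrite /g iavg_comm; apply: (averaging_le (avE k)) => s _.
  rewrite -(iavg_prod t _ (avg_averaging R V0)).
  by apply: (averaging_le (avE t)) => A _; rewrite natr_all.
have hk0 : 0 <= E k h by apply: (averaging_ge0 (avE k)).
apply: le_trans (lerXn2r (t ^ k) _ _ hg) _; rewrite ?nnegrE ?exprn_ge0 //.
  exact: le_trans (exprn_ge0 _ hk0) hg.
(* Second power mean, over the first list [A]; the induction hypothesis is then used for each [A]
   separately. *)
apply: le_trans (averaging_power_mean _ (avE t) _) _.
  by move=> A _; apply: (averaging_ge0 (avE k)).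
apply: (averaging_le (avE t)) => A _; apply: le_trans (IH _) _.
apply: (averaging_le (iavg_averaging k (avE t))) => Ts _.
by rewrite box_all.
Qed.

Lemma avg_mem (s : seq V) : avg (fun x => (x \in s)%:R) <= (size s)%:R / #|V|%:R :> R.
Proof.
rewrite /avg ler_wpM2r ?invr_ge0 // -natr_sum ler_nat.
by rewrite -big_mkcond sum1_card card_size.
Qed.

(** Union bound: a new entry repeats one of [t] others with probability at most [t / #|V|], and
    [t ^ 2 + t <= (t + 1) ^ 2]. *)
Lemma iavg_nuniq t : E t (fun s => (~~ uniq s)%:R) <= (t ^ 2)%:R / #|V|%:R.
Proof.
have n0 : 0 < (#|V|%:R)^-1 :> R by rewrite invr_gt0 ltr0n.
elim: t => [|t IH] /=; first by rewrite mul0r.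
apply: (@le_trans _ _ (avg (fun x => E t (fun s => (x \in s)%:R + (~~ uniq s)%:R)))).
  apply: (averaging_le (avg_averaging R V0)) => x _; apply: (averaging_le (avE t)) => s _.
  by rewrite negb_and negbK -natrD ler_nat; case: (x \in s); case: (uniq s).
under eq_fun do rewrite (averagingD (avE t)).
rewrite (averagingD (avg_averaging R V0)) (averaging_const (avg_averaging R V0)) iavg_avg_comm.
have : E t (fun s => avg (fun x => (x \in s)%:R)) <= t%:R / #|V|%:R.
  rewrite -[leRHS](averaging_const (avE t)); apply: (averaging_le (avE t)) => s [ss _].
  by rewrite -ss avg_mem.
move=> h; apply: le_trans (lerD h IH) _; rewrite -mulrDl ler_wpM2r // -?natrD ?ler_nat; first exact: ltW.
by rewrite -!mulnn; nia.
Qed.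

Lemma box_uniq_density k t (P : seq V -> bool) :
  E k (fun s => (P s)%:R) ^+ (t ^ k) - k%:R * ((t ^ 2)%:R / #|V|%:R) <=
  iavg (E t) k (fun Ts => (box P Ts && all uniq Ts)%:R).
Proof.
have avT l := iavg_averaging l (avE t).
have nu : iavg (E t) k (fun Ts => (~~ all uniq Ts)%:R) <= k%:R * ((t ^ 2)%:R / #|V|%:R).
  elim: k => [|k IH] /=; first by rewrite mul0r.
  apply: (@le_trans _ _ (E t (fun A => iavg (E t) k
      (fun Ts => (~~ uniq A)%:R + (~~ all uniq Ts)%:R)))).
    apply: (averaging_le (avE t)) => A _; apply: (averaging_le (avT k)) => Ts _.
    by rewrite negb_and -natrD ler_nat; case: (uniq A); case: (all uniq Ts).
  under eq_fun do rewrite (averagingD (avT k)) (averaging_const (avT k)).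
  rewrite (averagingD (avE t)) (averaging_const (avE t)) -natr1 mulrDl mul1r addrC.
  by rewrite lerD // iavg_nuniq.
apply: le_trans (lerB (box_density k t P) nu) _.
rewrite -(averagingB (avT k)); apply: (averaging_le (avT k)) => Ts _.
by case: (box P Ts); case: (all uniq Ts) => /=; lra.
Qed.

End Box.

(** * Cliques through prescribed sets *)

Section Density.
Variables (R : realType) (V : finType).
Hypothesis V0 : (0 < #|V|)%N.
Local Notation avV := (avg_averaging R V0).

Definition dens (P : pred V) : R := avg (fun x => (P x)%:R).

Lemma dens_ge0 P : 0 <= dens P.
Proof. by apply: (averaging_ge0 avV). Qed.

Lemma dens_le (P Q : pred V) : (forall x, P x -> Q x) -> dens P <= dens Q.
Proof.
move=> PQ; apply: (averaging_le avV) => x _; rewrite ler_nat.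
by case: (P x) (PQ x) => // ->.
Qed.

Lemma dens_ext (P Q : pred V) : P =1 Q -> dens P = dens Q.
Proof. by move=> PQ; congr avg; apply/funext => x; rewrite PQ. Qed.

Lemma densT : dens xpredT = 1.
Proof. exact: averaging1 avV. Qed.

Lemma dens_le1 P : dens P <= 1.
Proof. by rewrite -densT; apply: dens_le. Qed.

Lemma dens_split P Q : dens P = dens (fun x => P x && Q x) + dens (fun x => P x && ~~ Q x).
Proof.
rewrite /dens -(averagingD avV); congr avg; apply/funext => x.
by case: (P x); case: (Q x); rewrite /= ?addr0 ?add0r.
Qed.

Lemma densC P : dens (fun x => ~~ P x) = 1 - dens P.
Proof. by rewrite -densT (dens_split xpredT P) /= addrC addKr. Qed.

Lemma dens_card P : dens P * #|V|%:R = #|P|%:R.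
Proof.
rewrite /dens /avg divfK ?pnatr_eq0 -?lt0n // -natr_sum; congr _%:R.
by rewrite -sum1_card [in RHS]big_mkcond.
Qed.

Lemma dens_colour (I : finType) (chi : V -> I) P :
  dens P = \sum_i dens (fun x => P x && (chi x == i)).
Proof.
rewrite /dens -(averaging_sum avV); congr avg; apply/funext => x.
rewrite (bigD1 (chi x)) //= eqxx andbT big1 ?addr0 // => i.
by rewrite eq_sym => /negPf ->; rewrite andbF.
Qed.

(** Greedy choice in the order of [L]: a vertex taken from part [i] costs every later part at most
    [alpha i], so [sigma j] is left of part [j] after the parts in [L1] have been served. The
    induction cuts all parts down to the neighbours of the first vertex. Only earlier parts charge
    later ones, so the order of [L] matters. *)
Lemma clique_density (I : eqType) (e : rel V) (L : seq I) (B : I -> pred V)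
    (alpha sigma : I -> R) :
  uniq L -> (forall j, j \in L -> 0 <= sigma j) ->
  (forall i j x, i \in L -> j \in L -> i != j -> B i x ->
     dens (fun y => B j y && ~~ e x y) <= alpha i) ->
  (forall L1 j L2, L = L1 ++ j :: L2 ->
     \sum_(i <- L1) alpha i + sigma j <= dens (B j)) ->
  \prod_(j <- L) sigma j <=
  iavg (@avg R V) (size L) (fun s => (pairwise e s && all2 B L s)%:R).
Proof.
elim: L B => [|j0 L IH] B; first by rewrite big_nil.
move=> /= /andP[jL uL] s0 miss room; rewrite big_cons.
have p0 : 0 <= \prod_(j <- L) sigma j.
  by rewrite big_seq prodr_ge0 // => j jin; apply: s0; rewrite inE jin orbT.
apply: (@le_trans _ _ (avg (fun x => \prod_(j <- L) sigma j * (B j0 x)%:R))).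
  rewrite (averagingZ avV) mulrC ler_wpM2l //.
  by have := room [::] j0 L erefl; rewrite big_nil add0r.
have avL := iavg_averaging (size L) avV.
apply: (averaging_le avV) => x _; case: (boolP (B j0 x)) => Bx; last first.
  by rewrite mulr0; apply: (averaging_ge0 avL).
rewrite mulr1; apply: le_trans (IH (fun j y => B j y && e x y) uL _ _ _) _.
- by move=> j jin; apply: s0; rewrite inE jin orbT.
- move=> i j y iL jL' ij /andP[Biy _].
  apply: le_trans (miss i j y _ _ ij Biy); rewrite ?inE ?iL ?jL' ?orbT //.
  by apply: dens_le => z /andP[/andP[-> _] ->].
- move=> L1 j L2 defL; have := room (j0 :: L1) j L2; rewrite defL => /(_ erefl).
  have jin : j \in L by rewrite defL mem_cat mem_head orbT.
  have jj0 : j0 != j by apply: contraNneq jL => ->.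
  have := miss j0 j x (mem_head _ _) _ jj0 Bx; rewrite inE jin orbT => /(_ isT).
  by rewrite big_cons (dens_split (B j) (e x)); lra.
- apply: (averaging_le avL) => s _; rewrite ler_nat.
  have : all2 (fun j y => B j y && e x y) L s -> all (e x) s && all2 B L s.
    elim: L s {IH jL uL s0 miss room p0 avL} => [|j L IHL] [|y s] //=.
    by move=> /andP[/andP[-> ->] /IHL].
  case: (all2 (fun _ _ => _) _ _); last by rewrite andbF.
  by move=> /(_ isT)/andP[-> ->]; case: (pairwise e s).
Qed.

End Density.

(** * The Andrasfai-Erdos-Sos theorem *)

Section AndrasfaiErdosSos.
Variable T : finType.
Implicit Types (e : rel T) (A B Q : {set T}).

Definition clique e A : bool :=
  [forall x in A, forall y in A, (x != y) ==> e x y].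

Lemma cliqueP e A :
  reflect {in A &, forall x y, x != y -> e x y} (clique e A).
Proof.
apply: (iffP forall_inP) => [cA x y xA yA xy|cA x xA].
  by have /forall_inP/(_ _ yA)/implyP/(_ xy) := cA x xA.
by apply/forall_inP => y yA; apply/implyP; apply: cA.
Qed.

Lemma clique_add e A u : symmetric e -> clique e A -> {in A, forall z, e u z} ->
  clique e (u |: A).
Proof.
move=> sym /cliqueP cA uA; apply/cliqueP => x y /setU1P[->|xA] /setU1P[->|yA] xy.
- by rewrite eqxx in xy.
- exact: uA.
- by rewrite sym uA.
- exact: cA.
Qed.

Lemma clique_sub e A Q : Q \subset A -> clique e A -> clique e Q.
Proof.
by move=> /subsetP QA /cliqueP cA; apply/cliqueP => x y /QA xA /QA; apply: cA.
Qed.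

(** In an edge-maximal graph without cliques of size [r + 1], adding a missing edge [x y] creates
    such a clique; [Q] is this clique without [x] and [y]. *)
Lemma maximal_clique_free_extension e r :
  symmetric e -> irreflexive e -> (forall A, clique e A -> (#|A| <= r)%N) ->
  exists e' : rel T,
    [/\ symmetric e', irreflexive e', subrel e e',
        forall A, clique e' A -> (#|A| <= r)%N
      & forall x y, x != y -> ~~ e' x y ->
          exists Q, [/\ clique e' Q, #|Q| = r.-1, {in Q, forall z, e' x z}
                      & {in Q, forall z, e' y z}]].
Proof.
move=> sym irr free.
(* Relations are coded as sets of pairs so that [maxset] provides the maximal one. *)
pose rel_of (E : {set T * T}) : rel T := fun x y => (x, y) \in E.
pose P E := [&& [forall x, forall y, rel_of E x y == rel_of E y x],
  [forall x, ~~ rel_of E x x] & [forall A, clique (rel_of E) A ==> (#|A| <= r)%N]].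
have Pe : P [set p | e p.1 p.2].
  apply/and3P; split.
  - by apply/forallP => x; apply/forallP => y; rewrite /rel_of !inE /= sym.
  - by apply/forallP => x; rewrite /rel_of inE /= irr.
  - apply/forallP => A; apply/implyP => /cliqueP cA; apply: free; apply/cliqueP => x y xA yA xy.
    by have := cA x y xA yA xy; rewrite /rel_of inE.
have [E /maxsetP[PE maxE] eE] := maxset_exists Pe.
have /and3P[/forallP symE /forallP irrE /forallP freeE] := PE.
have symE' : symmetric (rel_of E) by move=> x y; apply/eqP; have /forallP := symE x; apply.
exists (rel_of E); split=> //.
- by move=> x; apply: negbTE.
- by move=> x y exy; apply: (subsetP eE); rewrite inE.
- by move=> A; apply/implyP.
move=> x y xy nexy; pose E' := (x, y) |: ((y, x) |: E).
have EE' a b : rel_of E' a b = [|| (a == x) && (b == y), (a == y) && (b == x) | rel_of E a b].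
  by rewrite /rel_of !inE.
have nPE' : ~~ P E'.
  apply/negP => PE'; have sE : E \subset E' by rewrite /E' setUA subsetUr.
  have defE := maxE _ PE' sE.
  by move: nexy; rewrite /rel_of -defE !inE eqxx.
have [A cA rA] : exists2 A, clique (rel_of E') A & (r < #|A|)%N.
  move: nPE'; rewrite /P negb_and negb_and => /or3P[].
  - move=> /negP[]; apply/forallP => a; apply/forallP => b; rewrite !EE' symE'.
    by rewrite [(b == x) && _]andbC [(b == y) && _]andbC orbCA.
  - move=> /negP[]; apply/forallP => a; rewrite EE' (negPf (irrE a)) orbF.
    by apply: contra xy => /orP[]/andP[/eqP<- /eqP<-].
  - by move=> /forallPn[A]; rewrite negb_imply -ltnNge => /andP[]; exists A.
have sub a (B : {set T}) : a \in [set x; y] -> B \subset A -> a \notin B -> clique (rel_of E) B.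
  move=> axy /subsetP BA aB; apply/cliqueP => u v uB vB uv.
  have /cliqueP/(_ u v (BA _ uB) (BA _ vB) uv) := cA; rewrite EE'.
  case/or3P=> // /andP[/eqP uE /eqP vE]; move: axy aB; rewrite !inE => /orP[]/eqP->.
  - by rewrite -uE uB.
  - by rewrite -vE vB.
  - by rewrite -vE vB.
  - by rewrite -uE uB.
have inA a : a \in [set x; y] -> a \in A.
  move=> axy; apply: contraLR rA => aA; rewrite -leqNgt.
  by have := freeE A; rewrite (sub a A).
have [xA yA] : x \in A /\ y \in A by split; apply: inA; rewrite !inE eqxx ?orbT.
have cAy : clique (rel_of E) (A :\ y).
  by apply: (sub y); rewrite ?subD1set ?inE ?eqxx ?orbT.
have cAx : clique (rel_of E) (A :\ x).
  by apply: (sub x); rewrite ?subD1set ?inE ?eqxx ?orbT.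
exists (A :\ y :\ x); split.
- exact: clique_sub (subD1set _ _) cAy.
- have := freeE (A :\ y); rewrite cAy /= => le.
  have := cardsD1 y A; have := cardsD1 x (A :\ y); rewrite !inE xA yA xy /=.
  by move: rA le; clear; lia.
- move=> z; rewrite !inE => /and3P[zx zy zA].
  by move/cliqueP: cAy; apply; rewrite ?inE ?xy ?zy // eq_sym.
- move=> z; rewrite !inE => /and3P[zx zy zA].
  by move/cliqueP: cAx; apply; rewrite ?inE ?zx 1?eq_sym ?xy // eq_sym.
Qed.

(** Non-adjacency is an equivalence relation and its classes are the colours. [pick] gives equal
    answers on extensionally equal predicates, so [rep] is constant on a class; the representatives
    form a clique, hence there are at most [r]. *)
Lemma complete_multipartite_colouring e r :
  symmetric e -> irreflexive e -> (0 < r)%N -> (forall A, clique e A -> (#|A| <= r)%N) ->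
  (forall x y z, ~~ e x y -> ~~ e y z -> ~~ e x z) ->
  exists chi : T -> 'I_r, forall x y, e x y -> chi x != chi y.
Proof.
move=> sym irr r0 free trans.
pose rep x := odflt x [pick y | ~~ e x y].
have repn x : ~~ e x (rep x).
  by rewrite /rep; case: pickP => [y //|_]; rewrite /= irr.
have rep_eq x y : ~~ e x y -> rep x = rep y.
  move=> nexy; rewrite /rep.
  have exy : (fun z => ~~ e x z) =1 (fun z => ~~ e y z).
    move=> z; apply/idP/idP => h; last exact: trans nexy h.
    by apply: trans h; rewrite sym.
  rewrite (eq_pick exy); case: pickP => // /(_ y).
  by rewrite irr.
pose A := [set rep x | x : T].
have rA : (#|A| <= r)%N.
  apply: free; apply/cliqueP => _ _ /imsetP[x _ ->] /imsetP[y _ ->].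
  apply: contraR => nrr; apply/eqP/rep_eq.
  have ryy : ~~ e (rep y) y by rewrite sym.
  exact: (trans _ _ _ (repn x) (trans _ _ _ nrr ryy)).
have memA x : rep x \in A by apply: imset_f.
have lt x : (enum_rank_in (memA x) (rep x) < r)%N by apply: leq_trans (ltn_ord _) rA.
exists (fun x => Ordinal (lt x)) => x y exy; apply: contraTneq exy => /(congr1 val) /= h.
have : rep x = rep y.
  have := congr1 (nth x (enum A)) h.
  rewrite -!(enum_val_nth x) !enum_rankK_in ?memA //.
move=> rr; apply: (trans _ _ _ (repn x)); by rewrite rr sym repn.
Qed.

(** The six upper bounds add up to less than [(k + 2 (r - 1) + 3) X], which is at most [(3 r - 1) X]
    because [k <= r - 2]. *)
Lemma weights_arith (r k X N a1 a2 a3 a4 a5 a6 : nat) : (k.+2 <= r)%N -> (N = 3 * r - 1)%N ->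
  (N * X <= a6 + a5 + a4 + a3 + a2 + a1)%N ->
  (a4 <= k * X)%N -> (a5 <= r.-1 * X)%N -> (a6 <= r.-1 * X)%N ->
  (a1 < X)%N -> (a2 < X)%N -> (a3 < X)%N -> False.
Proof.
case: r => // r kr ->; have -> : (3 * r.+1 - 1 = 3 * r + 2)%N by lia.
have : (k.+1 * X <= r * X)%N by rewrite leq_mul2r -ltnS kr orbT.
rewrite succnK mulSn mulnDl -mulnA; move: (k * X)%N (r * X)%N => A B; lia.
Qed.

(** If non-adjacency in the maximal supergraph is not transitive, there are an edge [x1 x2] and a
    vertex [c] such that [c] and [x1] share an [(r - 1)]-clique [Q1] and [c] and [x2] share [Q2].
    Choose them with [Q1 :&: Q2] as large as possible. Give weight 1 to [c], [x1], [x2], to each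
    member of [Q1] and of [Q2], and once more to each member of [Q1 :&: Q2]. Every vertex misses
    weight at least 3, the total weight is at most [3 r - 1], and the degree condition contradicts
    this double count. *)
Theorem andrasfai_erdos_sos e r :
  symmetric e -> irreflexive e -> (0 < r)%N -> (forall A, clique e A -> (#|A| <= r)%N) ->
  (forall x, ((3 * r - 1) * #|[set y | ~~ e x y]| < 3 * #|T|)%N) ->
  exists chi : T -> 'I_r, forall x y, e x y -> chi x != chi y.
Proof.
move=> sym0 irr0 r0 free0 miss0.
have [e' [sym irr ee' free ext]] := maximal_clique_free_extension sym0 irr0 free0.
have {miss0} miss x : ((3 * r - 1) * #|[set y | ~~ e' x y]| < 3 * #|T|)%N.
  apply: leq_ltn_trans (miss0 x); rewrite leq_mul2l subset_leq_card ?orbT //.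
  by apply/subsetP => y; rewrite !inE; apply/contra/ee'.
suff trans x y z : ~~ e' x y -> ~~ e' y z -> ~~ e' x z.
  have [chi chiP] := complete_multipartite_colouring sym irr r0 free trans.
  by exists chi => x y /ee'; apply: chiP.
move=> nxy nyz; apply/negP => exz.
pose nbr u Q := [forall w in Q, e' u w].
pose S (p : T * T * T * {set T} * {set T}) := let: (x1, x2, y, Q1, Q2) := p in
  [&& e' x1 x2, clique e' Q1, #|Q1| == r.-1, nbr x1 Q1, nbr y Q1,
      clique e' Q2, #|Q2| == r.-1, nbr x2 Q2 & nbr y Q2].
have nbrP u Q : reflect {in Q, forall w, e' u w} (nbr u Q) by exact: forall_inP.
have [p0 Sp0] : exists p, S p.
  have yx : y != x by apply: contraNneq nyz => ->.
  have yz : y != z by apply: contraNneq nxy => ->.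
  rewrite sym in nxy.
  have [Q1 [c1 s1 /nbrP y1 /nbrP x1]] := ext y x yx nxy.
  have [Q2 [c2 s2 /nbrP y2 /nbrP x2]] := ext y z yz nyz.
  by exists (x, z, y, Q1, Q2); rewrite /S exz c1 s1 c2 s2 x1 x2 y1 y2 !eqxx.
have [[[[[x1 x2] c] Q1] Q2] Sp max] := arg_maxnP (fun p => #|p.1.2 :&: p.2|) Sp0.
move: Sp => /and5P[e12 c1 /eqP s1 /nbrP x1Q /and5P[/nbrP cQ1 c2 /eqP s2 /nbrP x2Q /nbrP cQ2]].
rewrite /= in max.
(* With [r - 1] common vertices [Q1 = Q2], and [x1], [x2] and [Q1] would form a clique of size
   [r + 1]. *)
have kr : (#|Q1 :&: Q2|.+2 <= r)%N.
  have le1 : (#|Q1 :&: Q2| <= r.-1)%N by rewrite -s1 subset_leq_card ?subsetIl.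
  suff : #|Q1 :&: Q2| != r.-1 by move: le1; rewrite leq_eqVlt => /orP[->//|]; clear -r0; case: r r0.
  apply/eqP => kE.
  have Q12 : Q1 = Q2.
    have /eqP i1 : Q1 :&: Q2 == Q1 by rewrite eqEcard subsetIl s1 kE /=.
    have /eqP i2 : Q1 :&: Q2 == Q2 by rewrite eqEcard subsetIr s2 kE /=.
    by rewrite -[LHS]i1 i2.
  have x2Q' : {in Q1, forall w, e' x2 w} by rewrite Q12.
  have cl : clique e' (x1 |: (x2 |: Q1)).
    apply: clique_add => //; first exact: clique_add.
    by move=> w /setU1P[->|/x1Q].
  have := free _ cl; rewrite !cardsU1 s1 !inE.
  have -> : x2 \in Q1 = false by apply/negP => /x2Q'; rewrite irr.
  have -> : x1 \in Q1 = false by apply/negP => /x1Q; rewrite irr.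
  have -> : x1 == x2 = false by apply/negP => /eqP x12; rewrite x12 irr in e12.
  by rewrite /=; clear -r0; case: r r0 => // r' _; rewrite /= !add1n ltnn.
pose m u Q := #|[set w in Q | ~~ e' u w]|.
have m0 u Q w : w \in Q -> ~~ e' u w -> (0 < m u Q)%N.
  by move=> wQ uw; rewrite card_gt0; apply/set0Pn; exists w; rewrite inE wQ.
have noext u Q v : clique e' Q -> #|Q| = r.-1 -> {in Q, forall w, e' v w} ->
    e' u v -> (0 < m u Q)%N.
  move=> cQ sQ vQ uv; case: (posnP (m u Q)) => // /cards0_eq mu.
  have uQ : {in Q, forall w, e' u w}.
    move=> w wQ; apply: contraT => uw.
    by have := in_set0 w; rewrite -mu inE wQ uw.
  have cl : clique e' (u |: (v |: Q)).
    apply: clique_add => //; first exact: clique_add.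
    by move=> w /setU1P[->|/uQ].
  have := free _ cl; rewrite !cardsU1 sQ !inE.
  have -> : u \in Q = false by apply/negP => /uQ; rewrite irr.
  have -> : v \in Q = false by apply/negP => /vQ; rewrite irr.
  have -> : u == v = false by apply/negP => /eqP x12; rewrite x12 irr in uv.
  by rewrite /=; clear -r0; case: r r0 => // r' _; rewrite /= !add1n ltnn.
(* A missed vertex of [Q1 :&: Q2] counts three times. Otherwise [u] misses something in each of [Q1]
   with [x1], [Q1] with [c], [Q2] with [x2] and [Q2] with [c]; the total can stay below 3 only if
   [u] misses exactly one vertex of each [Qi] and none of [c], [x1], [x2]. *)
have three u : (3 <= m u Q1 + m u Q2 + m u (Q1 :&: Q2) + ~~ e' u c + ~~ e' u x1 + ~~ e' u x2)%N.
  have [mK|] := posnP (m u (Q1 :&: Q2)); last first.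
    rewrite card_gt0 => /set0Pn[w]; rewrite !inE => /andP[/andP[w1 w2] uw].
    have := m0 u Q1 w w1 uw; have := m0 u Q2 w w2 uw.
    have : (0 < m u (Q1 :&: Q2))%N by apply: (m0 u _ w) => //; rewrite inE w1.
    by clear; lia.
  have n1 : (~~ e' u x1 + m u Q1 > 0)%N.
    by case ux1: (e' u x1); rewrite //= (noext u Q1 x1).
  have n2 : (~~ e' u x2 + m u Q2 > 0)%N.
    by case ux2: (e' u x2); rewrite //= (noext u Q2 x2).
  case: (boolP (e' u c)) => uc /=; last by move: n1 n2; clear; lia.
  have n3 : (0 < m u Q1)%N by apply: (noext u Q1 c).
  have n4 : (0 < m u Q2)%N by apply: (noext u Q2 c).
  apply: contraT; rewrite -ltnNge => lt3.
  have [mu1 mu2 ux1 ux2] : [/\ m u Q1 = 1%N, m u Q2 = 1%N, e' u x1 & e' u x2].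
    by move: lt3; move: n3 n4; clear; case: (e' u x1); case: (e' u x2); split => //; lia.
  have uK w : w \in Q1 -> w \in Q2 -> e' u w.
    move=> w1 w2; apply: contraT => uw.
    by have := m0 u (Q1 :&: Q2) w; rewrite mK inE w1 w2 uw => /(_ isT isT).
  (* Exchange: [u] replaces the one vertex it misses in each clique. No common vertex is lost and
     [u] becomes common, against the maximality of [Q1 :&: Q2]. *)
  pose Q' Q := u |: [set w in Q | e' u w].
  have uQ' Q v : {in Q, forall w, e' v w} -> e' u v -> nbr v (Q' Q).
    move=> vQ uv; apply/nbrP => w /setU1P[->|]; first by rewrite sym.
    by rewrite inE => /andP[/vQ].
  have cQ' Q : clique e' Q -> clique e' (Q' Q).
    move=> cQ; apply: clique_add => //; last by move=> w; rewrite inE => /andP[].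
    by apply: clique_sub cQ; apply/subsetP => w; rewrite inE => /andP[].
  have sQ' Q : #|Q| = r.-1 -> m u Q = 1%N -> #|Q' Q| = r.-1.
    move=> <- mQ; rewrite cardsU1 inE irr andbF /= add1n -add1n -mQ /m.
    rewrite -[in RHS](cardsID [set w | e' u w] Q) addnC; congr (_ + _)%N.
      by apply: eq_card => w; rewrite !inE.
    by apply: eq_card => w; rewrite !inE andbC.
  have S' : S (x1, x2, c, Q' Q1, Q' Q2).
    by rewrite /S e12 !cQ' // !sQ' // !uQ' // !eqxx.
  have := max _ S'; rewrite /= leqNgt => /negP[].
  have uN : u \notin Q1 :&: Q2.
    by apply/negP; rewrite inE => /andP[w1 w2]; have := uK u w1 w2; rewrite irr.
  have -> : (#|Q1 :&: Q2|.+1 = #|u |: (Q1 :&: Q2)|)%N by rewrite cardsU1 uN.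
  apply: subset_leq_card; apply/subsetP => w; rewrite !inE.
  by case: (w == u) => //= /andP[w1 w2]; rewrite w1 w2 uK.
have tot Q : (\sum_u m u Q = \sum_(w in Q) #|[set u | ~~ e' w u]|)%N.
  under eq_bigr do rewrite /m -sum1_card.
  under [RHS]eq_bigr do rewrite -sum1_card.
  rewrite (exchange_big_dep (mem Q)) /=; last by move=> u w _; rewrite inE => /andP[].
  by apply: eq_bigr => w wQ; apply: eq_bigl => u; rewrite !inE wQ sym.
have tot1 w : (\sum_u ~~ e' u w = #|[set u | ~~ e' w u]|)%N.
  rewrite -sum1_card big_mkcond [in RHS]big_mkcond /=.
  by apply: eq_bigr => u _; rewrite inE sym; case: (e' w u).
have leQ Q : ((3 * r - 1) * \sum_u m u Q <= #|Q| * (3 * #|T|))%N.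
  rewrite tot big_distrr -sum_nat_const /=.
  by apply: leq_sum => w _; apply/ltnW/miss.
have := miss c; have := miss x1; have := miss x2.
rewrite -!tot1; have := leQ Q1; have := leQ Q2; have := leQ (Q1 :&: Q2).
have : (\sum_(u : T) 3 <= \sum_u (m u Q1 + m u Q2 + m u (Q1 :&: Q2)
         + ~~ e' u c + ~~ e' u x1 + ~~ e' u x2))%N by apply: leq_sum.
rewrite sum_nat_const !big_split /= s1 s2 => le3.
have H := leq_mul (leqnn (3 * r - 1)) le3; rewrite !mulnDr [(#|_| * 3)%N]mulnC in H.
move=> HK HQ2 HQ1 Hx2 Hx1 Hc.
apply: (weights_arith kr erefl); [exact: H|exact: HK|exact: HQ2|exact: HQ1|exact: Hx2|exact: Hx1|exact: Hc].
Qed.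

End AndrasfaiErdosSos.

(** * Cliques in nearly r-partite graphs *)

Lemma ler_sum_uniq (R : realType) (I : finType) (L : seq I) (P : pred I) (a : I -> R) :
  (forall i, 0 <= a i) -> uniq L -> (forall i, i \in L -> P i) ->
  \sum_(i <- L) a i <= \sum_(i | P i) a i.
Proof.
move=> a0 uL LP; rewrite big_uniq //= big_mkcond [leRHS]big_mkcond /=.
apply: ler_sum => i _; case: (boolP (i \in L)) => [/LP -> //|_].
by case: ifP.
Qed.

Section NearlyPartite.
Variables (R : realType) (T : finType) (r : nat) (e : rel T) (chi : T -> 'I_r).
Variables (q s : R) (Y : pred T).
Hypothesis T0 : (0 < #|T|)%N.
Local Notation dens := (@dens R T).
Local Notation E := (iavg (@avg R T)).

Definition class_dens i := dens (fun y => chi y == i).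
Definition cross_miss x := dens (fun y => (chi y != chi x) && ~~ e x y).

(* [s - class_dens i] bounds the density of the non-neighbours outside its class
   of a typical vertex of class [i]; these deficits sum to at most [q]. *)
Definition deficit i := s - class_dens i.

(** In the applications [q = 1 / (3 r - 1)] and [s = 3 q - eps / 2] with [eps <= q / 10]: then
    [3 r q = 1 + q] gives [rs], and [59 / 20 = 3 - 1 / 20]. *)
Hypotheses (q0 : 0 < q) (s_ge : 59%:R / 20%:R * q <= s) (rs : r%:R * s - 1 <= q).
Hypothesis class_le : forall i, class_dens i <= s.
Hypothesis Y_miss : forall x, Y x -> cross_miss x <= deficit (chi x).
Hypothesis Y_dens : dens (fun x => ~~ Y x) <= q / 16%:R.

Let deficit0 i : 0 <= deficit i.
Proof. by rewrite subr_ge0. Qed.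

Let sum_deficit : \sum_i deficit i <= q.
Proof.
rewrite sumrB sumr_const card_ord -mulr_natl; apply: le_trans rs; rewrite lerD2l lerN2.
by rewrite -[leLHS](densT R T0) (dens_colour R T0 chi).
Qed.

Let prefix_sum1 (L : seq 'I_r) j : uniq L -> (forall i, i \in L -> i != j) ->
  \sum_(i <- L) deficit i + deficit j <= q.
Proof.
move=> uL nj; apply: le_trans sum_deficit; rewrite [leRHS](bigD1 j) //= [leLHS]addrC lerD2l.
exact: ler_sum_uniq.
Qed.

Let prefix_sum2 (L : seq 'I_r) j k : uniq L -> j != k ->
  (forall i, i \in L -> i != j) -> (forall i, i \in L -> i != k) ->
  \sum_(i <- L) deficit i + deficit j + deficit k <= q.
Proof.
move=> uL jk nj nk; apply: le_trans sum_deficit.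
rewrite [leRHS](bigD1 j) //= [X in _ <= _ + X](bigD1 k) /=; last by rewrite eq_sym.
rewrite -addrA [leLHS]addrC -addrA !lerD2l.
by apply: ler_sum_uniq => // i iL; rewrite nj ?nk.
Qed.

Let others (c : 'I_r) := [seq j <- enum 'I_r | j != c].

Let othersP c : uniq (c :: others c) /\ c :: others c =i 'I_r.
Proof.
split; first by rewrite /= mem_filter eqxx filter_uniq ?enum_uniq.
by move=> j; rewrite inE mem_filter mem_enum andbT inE orbN.
Qed.

Let perm_others c : perm_eq (c :: others c) (enum 'I_r).
Proof.
have [u m] := othersP c; apply: uniq_perm => // [|j]; first exact: enum_uniq.
by rewrite m mem_enum.
Qed.

Let size_others c : size (c :: others c) = r.
Proof. by rewrite (perm_size (perm_others c)) size_enum_ord. Qed.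

Let size_rcons_others c : size (rcons (others c) c) = r.
Proof. by rewrite -[RHS](size_others c) size_rcons. Qed.

Let uniq_rcons_others c : uniq (rcons (others c) c).
Proof. by rewrite rcons_uniq; have [] := othersP c. Qed.

Let prefix_neq (L L1 L2 : seq 'I_r) j : uniq L -> L = L1 ++ j :: L2 ->
  forall i, i \in L1 -> i != j.
Proof.
move=> uL defL i iL1; apply: contraTneq uL => ij.
by rewrite defL cat_uniq /= -ij iL1 /= andbF.
Qed.

Let prefix_uniq (L L1 L2 : seq 'I_r) j : uniq L -> L = L1 ++ j :: L2 -> uniq L1.
Proof. by move=> uL defL; move: uL; rewrite defL cat_uniq => /andP[]. Qed.

Let prefix_rcons c L1 L2 j : rcons (others c) c = L1 ++ j :: L2 -> j != c ->
  forall i, i \in L1 -> i != c.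
Proof.
move=> defL jc i iL1; have := uniq_rcons_others c; apply: contraTneq => ic.
have := congr1 (last c) defL; rewrite last_rcons last_cat /= => cE.
have : c \in j :: L2 by rewrite {1}cE mem_last.
by rewrite defL cat_uniq -ic => cin; apply/negP => /and3P[_ /hasPn/(_ _ cin)]; rewrite /= iL1.
Qed.

Let miss_part (B : 'I_r -> pred T) :
  (forall j y, B j y -> (chi y == j) && Y y) ->
  forall i j x, i != j -> B i x -> dens (fun y => B j y && ~~ e x y) <= deficit i.
Proof.
move=> sB i j x ij Bx; have /andP[/eqP xi Yx] := sB _ _ Bx.
rewrite -xi; apply: le_trans (Y_miss Yx); apply: dens_le => // y /andP[By nexy].
by have /andP[/eqP yj _] := sB _ _ By; rewrite yj xi nexy eq_sym ij.
Qed.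

(** In the class of [x] no adjacency to [x] and [y] is asked. A vertex there completes an
    [r]-clique, and its blow-up later receives the isolated vertices of the two-coloured part of
    [H]. *)
Definition common_clique_set x y (j : 'I_r) (z : T) : bool :=
  [&& chi z == j, Y z & (j == chi x) || e x z && e y z].

(** The class [c] of [x] comes last. A class [j] before it pays [deficit c] twice, for [x] and for
    [y], besides [deficit j] and the prefix. One copy of [deficit c] shares the budget [q] with the
    prefix and [deficit j], the other is at most [q], and [s - 2 q - q / 16 >= q / 4]. *)
Lemma common_clique_density x y : chi y = chi x ->
  cross_miss x <= deficit (chi x) -> cross_miss y <= deficit (chi x) ->
  (q / 4%:R) ^+ r <= E r (fun t => (pairwise e t &&
     all2 (common_clique_set x y) (rcons [seq j <- enum 'I_r | j != chi x] (chi x)) t)%:R).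
Proof.
move=> yx mx my; set c := chi x in mx my yx *.
have := @clique_density R T T0 _ e (rcons (others c) c) (common_clique_set x y)
  deficit (fun=> q / 4%:R) (uniq_rcons_others c).
rewrite big_const_seq count_predT iter_mulr_1 size_rcons_others; apply.
- by move=> j _; rewrite divr_ge0 // ltW.
- by move=> i j z _ _; apply: miss_part => k w /and3P[-> -> _].
pose D (j : 'I_r) := dens (fun z => (chi z == j) && Y z).
suff room (L1 L2 : seq 'I_r) (j : 'I_r) : rcons (others c) c = L1 ++ j :: L2 ->
    \sum_(i <- L1) deficit i + q / 4%:R <= dens (common_clique_set x y j).
  by move=> L1 j L2; apply: room.
move=> defL; have uL1 := prefix_uniq (uniq_rcons_others c) defL.
have nj := prefix_neq (uniq_rcons_others c) defL.
have splitY : class_dens j <= D j + q / 16%:R.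
  rewrite /class_dens (dens_split R T0 _ Y) /D lerD2l; apply: le_trans Y_dens.
  by apply: dens_le => // z /andP[].
have dE i : class_dens i = s - deficit i by rewrite /deficit; lra.
rewrite dE in splitY.
have [jc|jc] := eqVneq j c.
  have : dens (common_clique_set x y j) = D j.
    by apply: dens_ext => z; rewrite /common_clique_set -/c jc eqxx /= andbT.
  by have := prefix_sum1 uL1 nj; have := q0; have := s_ge; lra.
have h1 : D j <=
    dens (common_clique_set x y j) + deficit c + deficit c.
  rewrite /D (dens_split R T0 _ (e x)) (dens_split R T0 (fun z => _ && e x z) (e y)).
  rewrite lerD ?lerD //.
  - apply: dens_le => // z; rewrite /common_clique_set.
    by move=> /andP[/andP[/andP[-> ->] ->] ->]; rewrite orbT.
  - apply: le_trans my; apply: dens_le => // z.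
    by rewrite yx => /andP[/andP[/andP[/eqP-> _] _] ->]; rewrite jc.
  - apply: le_trans mx; apply: dens_le => // z.
    by move=> /andP[/andP[/eqP-> _] ->]; rewrite jc.
have := prefix_sum2 uL1 jc nj (prefix_rcons defL jc).
have : deficit c <= q.
  by have := @prefix_sum1 [::] c isT; rewrite big_nil add0r; apply.
by have := q0; have := s_ge; lra.
Qed.

Definition nbr_dens x j := dens (fun z => (chi z == j) && e x z).

(* If [x] has few neighbours in its own class, or if that class has a deficit
   well below [q], a clique can be built starting inside the class; otherwise
   the other classes have small deficits and the own class comes last. *)
Lemma neighbourhood_clique_density x (d := nbr_dens x (chi x)) :
  q <= 1 / 2%:R -> dens (fun z => ~~ e x z) <= 2%:R * s - 3%:R * q ->
  (forall j, d <= nbr_dens x j) -> dens (fun z => ~~ Y z) <= d / 2%:R ->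
  (q / 16%:R) ^+ r * d <= E r (fun t => (pairwise e t && all (e x) t)%:R).
Proof.
move=> q2 miss dmin Yd; set c := chi x in d dmin Yd *.
have d0 : 0 <= d by apply: dens_ge0.
have d1 : d <= 1 by apply: dens_le1.
have [h0 h1] := (q0, s_ge).
have qd : q / 16%:R * d <= q / 16%:R by rewrite -[leRHS]mulr1 ler_wpM2l //; lra.
have qd' : q / 16%:R * d <= d / 32%:R by rewrite mulrC ler_wpM2l //; lra.
pose B (j : 'I_r) z := [&& chi z == j, Y z & e x z].
(* The own class is only known to contain density [d] of neighbours, so its share is scaled by [d];
   this is the factor [d] of the conclusion. *)
pose sigma j := if j == c then q / 16%:R * d else q / 16%:R.
have BY j : nbr_dens x j <= dens (B j) + dens (fun z => ~~ Y z).
  rewrite /nbr_dens (dens_split R T0 _ Y) lerD //; last by apply: dens_le => // z /andP[].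
  by apply: dens_le => // z /andP[/andP[? ?] ?]; apply/and3P.
have build (L : seq 'I_r) : uniq L -> perm_eq L (enum 'I_r) ->
    (forall (L1 L2 : seq 'I_r) (j : 'I_r), L = L1 ++ j :: L2 ->
      \sum_(i <- L1) deficit i + sigma j <= dens (B j)) ->
    (q / 16%:R) ^+ r * d <= E r (fun t => (pairwise e t && all (e x) t)%:R).
  move=> uL pL room; have sL : size L = r by rewrite (perm_size pL) size_enum_ord.
  have -> : (q / 16%:R) ^+ r * d = \prod_(j <- L) sigma j.
    rewrite (perm_big _ pL) big_enum /= (bigD1 c) //= {1}/sigma eqxx.
    rewrite (eq_bigr (fun=> q / 16%:R)); last by move=> j /negPf jc; rewrite /sigma jc.
    rewrite prodr_const cardC1 card_ord mulrAC; congr (_ * d); rewrite -exprS.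
    by rewrite prednK // (leq_ltn_trans _ (ltn_ord c)).
  rewrite -[X in E X]sL; apply: le_trans (@clique_density R T T0 _ e L B deficit sigma uL _ _ _) _.
  - by move=> j _; rewrite /sigma; case: ifP => _; [apply: mulr_ge0|]; lra.
  - by move=> i j z _ _; apply: miss_part => k y /and3P[-> ->].
  - by move=> L1 j L2; apply: room.
  apply: (averaging_le (iavg_averaging _ (avg_averaging R T0))) => t _; rewrite ler_nat.
  case: (pairwise e t) => //=; have : all2 B L t -> all (e x) t.
    by elim: (L) t => [|j L' IH] [|z t] //= /andP[/and3P[_ _ ->] /IH].
  by case: (all2 B L t) => // /(_ isT) ->.
(* The classes [c] and [j] together lose at most all non-neighbours of [x]. In the application the
   bound [2 s - 3 q] on these equals [3 q - eps]. *)
have dcj j : j != c -> 3%:R * q - deficit c - deficit j <= d + nbr_dens x j.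
  move=> jc; rewrite /deficit /class_dens (dens_split R T0 (fun y => chi y == c) (e x)).
  rewrite (dens_split R T0 (fun y => chi y == j) (e x)) -/(nbr_dens x c) -/(nbr_dens x j).
  suff : dens (fun y => (chi y == c) && ~~ e x y) + dens (fun y => (chi y == j) && ~~ e x y)
      <= dens (fun z => ~~ e x z) by move: miss; rewrite /d; lra.
  rewrite [leRHS](dens_split R T0 _ (fun y => chi y == c)); apply: lerD.
    by apply: dens_le => // y /andP[-> ->].
  by apply: dens_le => // y /andP[/eqP-> ->].
have sc : deficit c <= q.
  by have := @prefix_sum1 [::] c isT; rewrite big_nil add0r; apply.
(* The origin of [16]: when [4 * deficit c <= 3 * q], [dcj] and [d <= nbr_dens x j] make
   [nbr_dens x j] at least half of [3 q - deficit c - deficit j]. After the prefix [q / 8] remains,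
   of which [q / 16] may lie outside [Y]. *)
have first : 2%:R * d <= q \/ 4%:R * deficit c <= 3%:R * q ->
    (q / 16%:R) ^+ r * d <= E r (fun t => (pairwise e t && all (e x) t)%:R).
  move=> small; have [uL _] := othersP c; apply: (build _ uL (perm_others c)).
  move=> L1 L2 j defL; have uL1 := prefix_uniq uL defL; have nj := prefix_neq uL defL.
  rewrite /sigma; have [jc|jc] := eqVneq j c.
    have -> : L1 = [::].
      by case: L1 defL nj {uL1} => // k L1 [<- _] /(_ c (mem_head _ _)); rewrite jc eqxx.
    rewrite big_nil add0r; have := BY j; rewrite jc -/d; lra.
  have := prefix_sum1 uL1 nj; have := BY j; have := dcj j jc; have := dmin j.
  by have := deficit0 j; have := Y_dens; case: small => small; lra.
have [|d_big] := leP (2%:R * d) q; first by move=> dq; apply: first; left.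
have [|c_big] := leP (4%:R * deficit c) (3%:R * q); first by move=> cq; apply: first; right.
have pL : perm_eq (rcons (others c) c) (enum 'I_r).
  by rewrite perm_rcons perm_others.
apply: (build _ (uniq_rcons_others c) pL) => L1 L2 j defL.
have uL1 := prefix_uniq (uniq_rcons_others c) defL.
have nj := prefix_neq (uniq_rcons_others c) defL; rewrite /sigma.
have YD := Y_dens; have [jc|jc] := eqVneq j c.
  by have := prefix_sum1 uL1 nj; have := BY j; rewrite jc -/d; lra.
have := prefix_sum2 uL1 jc nj (prefix_rcons defL jc).
by have := BY j; have := dcj j jc; have := dmin j; have := deficit0 j; lra.
Qed.

End NearlyPartite.

(** * Colouring by random sampling *)

Section Subsequences.
Variables (R : realType) (V : finType).
Hypothesis V0 : (0 < #|V|)%N.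
Local Notation E := (iavg (@avg R V)).
Let avV := avg_averaging R V0.
Let avE k := iavg_averaging k avV.

Fixpoint nsubseq (T : Type) (k : nat) (P : seq T -> bool) (s : seq T) {struct s} : nat :=
  if k is k'.+1 then
    if s is x :: s' then nsubseq k' (fun t => P (x :: t)) s' + nsubseq k P s' else 0%N
  else P [::].

Lemma nsubseq_gt0 (T : eqType) (P : seq T -> bool) t s :
  subseq t s -> P t -> (0 < nsubseq (size t) P s)%N.
Proof.
elim: s t P => [|x s IH] [|y t] P //=; [by move=> _ ->|by move=> _ ->|].
rewrite addn_gt0; case: eqP => [<- sub Pt|_ sub Pt].
  by rewrite (IH t (fun t => P (y :: t)) sub Pt).
by rewrite (IH (y :: t) P sub Pt) orbT.
Qed.

(** Union bound over the choices of [k] positions, each of which carries a uniform random sequence.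
    The factor [2 ^ M] is crude but harmless, as the sample size is fixed before the clique
    density. *)
Lemma iavg_nsubseq M k (P : seq V -> bool) :
  E M (fun s => (nsubseq k P s)%:R) <= 2%:R ^+ M * E k (fun t => (P t)%:R).
Proof.
have E0 l Q : 0 <= E l (fun t => (Q t : nat)%:R) by apply: (averaging_ge0 (avE l)).
elim: M k P => [|M IH] k P.
  by case: k => [|k]; rewrite expr0 mul1r //; apply: E0.
case: k => [|k] /=.
  rewrite (averaging_const avV (E M _)) (averaging_const (avE M)).
  by rewrite ler_peMl // -natrX ler1n expn_gt0.
apply: (@le_trans _ _ (avg (fun x : V => 2%:R ^+ M * E k (fun t => (P (x :: t))%:R)
    + 2%:R ^+ M * E k.+1 (fun t => (P t)%:R)))).
  apply: (averaging_le avV) => x _; apply: le_trans (lerD (IH _ _) (IH _ _)).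
  by rewrite -(averagingD (avE M)); under eq_fun do rewrite natrD.
rewrite (averagingD avV) (averagingZ avV) (averaging_const avV) exprS /=.
by rewrite -mulrA mulr_natl mulr2n.
Qed.

End Subsequences.

(** * A Chernoff bound for degrees inside a random sample *)

Section Chernoff.
Variables (R : realType) (V : finType) (e : rel V) (h theta : R).
Hypothesis V0 : (0 < #|V|)%N.
Hypotheses (h0 : 0 < h) (h1 : h <= 1 / 2%:R) (theta0 : 0 <= theta) (theta1 : theta <= 1).
Local Notation E := (iavg (@avg R V)).
Let avV := avg_averaging R V0.
Let avE k := iavg_averaging k avV.

Lemma prod_le1 (s : seq V) (u : V -> R) : (forall x, 0 <= u x) ->
  \sum_(x <- s) u x <= (size s)%:R -> \prod_(x <- s) u x <= 1.
Proof.
move=> u0; have -> : \sum_(x <- s) u x = \sum_(i < size s) u (tnth (in_tuple s) i).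
  exact: big_tnth.
have -> : \prod_(x <- s) u x = \prod_(i < size s) u (tnth (in_tuple s) i).
  exact: big_tnth.
move=> sle.
have [+ _] := @leif_AGM R 'I_(size s) xpredT (fun i => u (tnth (in_tuple s) i)) (fun i _ => u0 _).
move=> /le_trans; apply; apply: exprn_ile1.
  by rewrite mulr_ge0 ?invr_ge0 ?ler0n // sumr_ge0.
have div_le1 (S : R) n : S <= n%:R -> S / n%:R <= 1.
  case: n => [|n]; first by rewrite invr0 mulr0 ler01.
  by rewrite ler_pdivrMr ?ltr0n // mul1r.
by rewrite card_ord; apply: div_le1.
Qed.

Let hi := 1 - h * (1 - theta).
Let lo := 1 + h * theta.

Let hi_ge : 1 / 2%:R <= hi.
Proof. by rewrite /hi; move: h0 h1 theta0 theta1 => *; nra. Qed.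

Let lo_ge : 1 <= lo.
Proof. by rewrite /lo; move: h0 h1 theta0 theta1 => *; nra. Qed.

(* The weights replace the exponential moments [exp (h * (x - theta))]. *)
Definition miss_weight x y := if e x y then lo^-1 else hi^-1.

Lemma miss_weight_ge0 x y : 0 <= miss_weight x y.
Proof.
rewrite /miss_weight; case: ifP => _; rewrite invr_ge0; move: hi_ge lo_ge; lra.
Qed.

Lemma miss_weight_le x y : miss_weight x y <= 2%:R.
Proof.
have := hi_ge; have := lo_ge; rewrite /miss_weight; case: ifP => _ g1 g2.
  by rewrite invf_ple ?posrE; lra.
by rewrite invf_ple ?posrE; lra.
Qed.

(** If a share [theta] of [s] is missed, the numbers [lo] and [hi] have mean at most 1 over [s], so
    by AM-GM their product is at most 1. *)
Lemma prod_miss_weight x (s : seq V) :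
  theta * (size s)%:R <= (count (fun y => ~~ e x y) s)%:R ->
  1 <= \prod_(y <- s) miss_weight x y.
Proof.
have hg := hi_ge; have lg := lo_ge.
pose u y := if e x y then lo else hi.
have u0 y : 0 < u y by rewrite /u; case: ifP => _; lra.
have -> : \prod_(y <- s) miss_weight x y = (\prod_(y <- s) u y)^-1.
  rewrite -prodfV; apply: eq_bigr => y _; rewrite /miss_weight /u.
  by case: ifP.
move=> le; rewrite invf_ge1; last by apply: prodr_gt0.
apply: prod_le1 => [y|]; first exact: ltW.
have -> : \sum_(y <- s) u y = lo * (size s)%:R - h * (count (fun y => ~~ e x y) s)%:R.
  elim: s {le} => [|y s IH]; first by rewrite big_nil /= !mulr0 subr0.
  rewrite big_cons IH /= !natrD -natr1 /u /lo /hi; case: (e x y) => /=; ring.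
have := ler_wpM2l (ltW h0) le; rewrite /lo; lra.
Qed.

(** The mean weight [p / hi + (1 - p) / lo] at [p = theta - h], using [lo - hi = h]. *)
Definition chernoff_rate := (hi + (theta - h) * h) / (hi * lo).

(** The denominator exceeds the numerator by [h ^ 2 (1 - theta (1 - theta))]. *)
Lemma chernoff_rate_bounds : h <= theta -> 0 <= chernoff_rate < 1.
Proof.
move=> hth; have := hi_ge; have := lo_ge => lg hg.
have hl0 : 0 < hi * lo by nra.
apply/andP; split.
  by apply: divr_ge0; [move: h0; nra|exact: ltW].
rewrite /chernoff_rate ltr_pdivrMr // mul1r /lo /hi.
by have := h0; have := h1; nra.
Qed.

Lemma avg_miss_weight x : dens R (fun y => ~~ e x y) <= theta - h ->
  avg (miss_weight x) <= chernoff_rate.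
Proof.
have hg := hi_ge; have lg := lo_ge; move=> le.
have -> : avg (miss_weight x) =
    lo^-1 + (hi^-1 - lo^-1) * dens R (fun y => ~~ e x y).
  rewrite -(averaging_const avV lo^-1) -(averagingZ avV) -(averagingD avV).
  congr avg; apply/funext => y; rewrite (averaging_const avV) /miss_weight.
  by case: (e x y) => /=; ring.
have d0 : 0 <= hi^-1 - lo^-1.
  rewrite subr_ge0 lef_pV2 ?posrE; try lra.
  by rewrite /hi /lo; have := h0; lra.
apply: le_trans (lerD (lexx _) (ler_wpM2l d0 le)) _.
rewrite le_eqVlt; apply/orP; left; apply/eqP; rewrite /chernoff_rate.
have [hi0 lo0] : hi != 0 /\ lo != 0 by split; lra.
have -> : hi + (theta - h) * h = hi + (theta - h) * (lo - hi) by rewrite /lo /hi; ring.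
by field; apply/andP.
Qed.

(** The tested vertex belongs to the sample: its own factor is bounded by 2, and the other [M]
    entries are independent of it. *)
Lemma iavg_sum_prod_miss_weight M : h <= theta ->
  (forall x, dens R (fun y => ~~ e x y) <= theta - h) ->
  E M.+1 (fun s => \sum_(x <- s) \prod_(y <- s) miss_weight x y) <=
  M.+1%:R * 2%:R * chernoff_rate ^+ M.
Proof.
move=> hth miss; have /andP[rho0 _] := chernoff_rate_bounds hth.
set rho := chernoff_rate in rho0 *.
pose S s := \sum_(x <- s) \prod_(y <- s) miss_weight x y.
have p0 x (s : seq V) : 0 <= \prod_(y <- s) miss_weight x y.
  by rewrite prodr_ge0 // => y _; apply: miss_weight_ge0.
have S0 s : 0 <= S s by apply: sumr_ge0.
have Ep x l : E l (fun s => \prod_(y <- s) miss_weight x y) <= rho ^+ l.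
  rewrite (iavg_prod l (miss_weight x) avV); apply: lerXn2r; rewrite ?nnegrE //.
    by apply: (averaging_ge0 avV) => y _; apply: miss_weight_ge0.
  exact: avg_miss_weight.
have step l : E l.+1 S <= 2%:R * rho ^+ l + rho * E l S.
  apply: (@le_trans _ _ (avg (fun z => E l (fun s => 2%:R * \prod_(y <- s) miss_weight z y
      + \sum_(x <- s) miss_weight x z * \prod_(y <- s) miss_weight x y)))).
    apply: (averaging_le avV) => z _; apply: (averaging_le (avE l)) => s _.
    rewrite /S big_cons big_cons lerD ?ler_wpM2r ?miss_weight_le //.
    by under eq_bigr do rewrite big_cons.
  under eq_fun do rewrite (averagingD (avE l)) (averagingZ (avE l)).
  rewrite (averagingD avV) (averagingZ avV) lerD //.
    rewrite ler_wpM2l // -[leRHS](averaging_const avV); exact: (averaging_le avV).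
  rewrite iavg_avg_comm -(averagingZ (avE l)); apply: (averaging_le (avE l)) => s _.
  rewrite (averaging_sum avV) /S mulr_sumr; apply: ler_sum => x _.
  under eq_fun do rewrite mulrC; rewrite (averagingZ avV) mulrC ler_wpM2r //.
  exact: avg_miss_weight.
elim: M => [|M IH].
  apply: le_trans (step 0%N) _; rewrite /S /= big_nil mulr0 addr0 expr0; lra.
apply: le_trans (step M.+1) _.
have := ler_wpM2l rho0 IH; rewrite -/S exprS -[M.+2%:R]natr1.
move: (rho ^+ M) => p; lra.
Qed.

End Chernoff.

Lemma mem_uniq_full (r : nat) (L : seq 'I_r) c : uniq L -> size L = r -> c \in L.
Proof.
move=> uL sL; apply: contraT => cL.
have : uniq (c :: L) by rewrite /= cL.
by move/card_uniqP => h; have := max_card (mem (c :: L)); rewrite h card_ord /= sL ltnn.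
Qed.

Section ColouredCliques.
Variables (T : eqType) (r : nat) (e : rel T) (chi : T -> 'I_r).
Hypothesis chiP : forall x y, e x y -> chi x != chi y.

Lemma clique_colours_uniq t : pairwise e t -> uniq (map chi t).
Proof. by rewrite uniq_pairwise pairwise_map; apply: sub_pairwise. Qed.

Lemma common_clique_same_colour x y Q : size Q = r.-1 -> pairwise e Q ->
  all (e x) Q -> all (e y) Q -> chi x = chi y.
Proof.
move=> sQ cQ xQ yQ; have r0 : (0 < r)%N by apply: leq_ltn_trans (ltn_ord (chi x)).
have : chi y \in map chi (x :: Q).
  apply: mem_uniq_full; last by rewrite size_map /= sQ prednK.
  by apply: clique_colours_uniq; rewrite /= xQ.
rewrite inE => /predU1P[-> //|/mapP[z zQ yz]].
by have := chiP (allP yQ z zQ); rewrite yz eqxx.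
Qed.

End ColouredCliques.

Lemma all2_rcons_inv (S T : Type) (P : S -> T -> bool) L c t : all2 P (rcons L c) t ->
  exists Q z, [/\ t = rcons Q z, all2 P L Q & P c z].
Proof.
elim: L t => [|j L IH] [|z t] //=.
  by case: t => [|w t]; rewrite ?andbF ?andbT // => Pcz; exists [::], z.
by move=> /andP[Pjz /IH[Q [w [-> LQ Pcw]]]]; exists (z :: Q), w; rewrite /= Pjz.
Qed.

Lemma all2_all (S : eqType) (T : Type) (P : S -> T -> bool) (Q : pred T) L t :
  (forall j z, j \in L -> P j z -> Q z) -> all2 P L t -> all Q t.
Proof.
elim: L t => [|j L IH] [|z t] //= PQ /andP[Pjz Lt].
rewrite (PQ j z) ?mem_head //=; apply: IH Lt => k w kL; apply: PQ.
by rewrite inE kL orbT.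
Qed.

(** * Colour classes read off a good sample *)

Section Sample.
Variables (R : realType) (V : finType) (r : nat) (e : rel V) (q eps : R).
Hypotheses (sym : symmetric e) (irr : irreflexive e) (r0 : (0 < r)%N).
Hypotheses (qE : q = (3%:R * r%:R - 1)^-1) (eps0 : 0 < eps) (eps_le : eps <= q / 10%:R).

Let q0 : 0 < q.
Proof.
rewrite qE invr_gt0 subr_gt0; have : (1 <= r%:R :> R) by rewrite ler1n.
lra.
Qed.

Let rq : (3%:R * r%:R - 1) * q = 1.
Proof. by rewrite qE divff // -invr_eq0 -qE gt_eqF. Qed.

Definition bad_sample (s : seq V) : bool :=
  has (fun x => (3%:R * q - eps / 2%:R) * (size s)%:R <= (count (fun y => ~~ e x y) s)%:R) s
  || (0 < nsubseq r.+1 (pairwise e) s)%N.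

(** Each good sample [[:: u, v & s0]] has its own proper colouring, which varies with [u] and [v].
    Having a common [(r - 1)]-clique in [s0] forces equal colours in all of them, so this relation
    gives a colour that depends on [s0] alone. *)
Definition share (s0 : seq V) (a b : V) : bool :=
  [exists Q : (r.-1).-tuple V,
     [&& all (mem s0) Q, pairwise e Q, all (e a) Q & all (e b) Q]].

Section Good.
Variables (m : nat) (u v : V) (s0 : seq V).
Hypotheses (sm : size s0 = m) (m_large : 32%:R <= m.+2%:R * q).
Hypothesis good : ~~ bad_sample [:: u, v & s0].
Let s := [:: u, v & s0].
(** A sample may repeat vertices, so the graph to be coloured lives on positions; repetitions become
    non-adjacent twins. *)
Let f (i : 'I_m.+2) := nth u s i.
Let e' : rel 'I_m.+2 := fun i j => e (f i) (f j).

Let sizes : size s = m.+2. Proof. by rewrite /= sm. Qed.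

Let f_enum : map f (enum 'I_m.+2) = s.
Proof.
apply: (@eq_from_nth _ u); first by rewrite size_map size_enum_ord sizes.
move=> i; rewrite size_map size_enum_ord => lti.
by rewrite (nth_map ord0) ?size_enum_ord // /f nth_enum_ord.
Qed.

Let miss_lt i : #|[set j | ~~ e' i j]|%:R < (3%:R * q - eps / 2%:R) * m.+2%:R.
Proof.
have -> : #|[set j | ~~ e' i j]| = count (fun y => ~~ e (f i) y) s.
  rewrite -f_enum count_map -size_filter cardE enumT; congr size.
  by apply: eq_filter => j; rewrite !inE.
have : f i \in s by apply: mem_nth; rewrite sizes.
move: good; rewrite /bad_sample negb_or => /andP[/hasPn h _] /h.
by rewrite -/s sizes -ltNge.
Qed.

Let colouring : exists chi : 'I_m.+2 -> 'I_r, forall x y, e' x y -> chi x != chi y.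
Proof.
apply: andrasfai_erdos_sos => //.
- by move=> i j; rewrite /e' sym.
- by move=> i; rewrite /e' irr.
- move=> A /cliqueP cA; rewrite leqNgt; apply/negP => rA.
  move: good; rewrite /bad_sample negb_or => /andP[_ /negP]; apply.
  pose t := map f (take r.+1 (enum A)).
  have st : size t = r.+1.
    by rewrite size_map size_takel // -cardE.
  rewrite -st; apply: nsubseq_gt0.
    rewrite -/s -f_enum map_subseq //; apply: subseq_trans (take_subseq _ _) _.
    by rewrite [X in subseq _ X]enumT; apply: filter_subseq.
  rewrite pairwise_map; apply: (@subseq_pairwise _ _ _ (enum A)); first exact: take_subseq.
  apply: (@sub_in_pairwise _ (mem A) [rel x y | x != y]).
  + by move=> x y xA yA /= xy; apply: cA.
  + by apply/allP => x; rewrite mem_enum.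
  + by rewrite -uniq_pairwise enum_uniq.
- move=> i; rewrite -(ltr_nat R) !natrM card_ord natrB; last by lia.
  have := miss_lt i; rewrite natrM; set c := _%:R => h.
  have N0 : 0 < 3%:R * r%:R - 1 :> R by rewrite -invr_gt0 -qE.
  have : (3%:R * r%:R - 1) * c < (3%:R * r%:R - 1) * ((3%:R * q - eps / 2%:R) * m.+2%:R).
    by rewrite ltr_pM2l.
  have : 0 <= (3%:R * r%:R - 1) * (eps / 2%:R * m.+2%:R) :> R.
    by rewrite (mulr_ge0 (ltW N0)) // mulr_ge0 // divr_ge0 // ltW.
  have := congr1 (fun z => z * (m.+2%:R : R)) rq; rewrite mul1r.
  by move: (m.+2%:R : R) (3%:R * r%:R - 1 : R) => M N h1 h2 h3; lra.
Qed.

Let common_cliques (chi : 'I_m.+2 -> 'I_r) x y :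
  (forall x y, e' x y -> chi x != chi y) -> chi y = chi x ->
  exists Q z, [/\ size Q = r.-1, pairwise e' (rcons Q z),
    all (fun i : 'I_m.+2 => (2 <= i)%N) (rcons Q z), all (e' x) Q & all (e' y) Q].
Proof.
(* Positions 0 and 1 carry [u] and [v]; leaving them out of [Y] puts the cliques inside [s0]. They
   make up [2 / (m + 2)] of the positions, which [m_large] bounds by [q / 16]. *)
move=> chiP yx; pose S : R := 3%:R * q - eps / 2%:R; pose Y (i : 'I_m.+2) := (2 <= i)%N.
have T0 : (0 < #|'I_m.+2|)%N by rewrite card_ord.
have M0 : 0 < m.+2%:R :> R by rewrite ltr0n.
have missS i : dens R (fun j => ~~ e' i j) <= S.
  rewrite -(ler_pM2r M0) -[X in _ * X%:R](card_ord m.+2) (dens_card R T0).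
  by apply: ltW; rewrite (_ : #|_| = #|[set j | ~~ e' i j]|) ?miss_lt // cardsE.
have own i : dens R (fun j => ~~ e' i j) = class_dens R chi (chi i) + cross_miss R e' chi i.
  rewrite (dens_split R T0 _ (fun j => chi j == chi i)); congr (_ + _).
    apply: dens_ext => j /=; rewrite andbC; case: eqP => //= ji.
    by apply/negP => /chiP; rewrite ji eqxx.
  by apply: dens_ext => j /=; rewrite andbC.
have S0 : 0 <= S by rewrite /S; have := q0; have := eps_le; lra.
have H1 : 59%:R / 20%:R * q <= S by rewrite /S; have := q0; have := eps_le; lra.
have H2 : r%:R * S - 1 <= q.
  by rewrite /S; have := rq; have := mulr_ge0 (ler0n R r) (ltW eps0); lra.
have H3 i : class_dens R chi i <= S.
  case: (pickP (fun j => chi j == i)) => [j /eqP <-|none].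
    have := missS j; rewrite own.
    have : 0 <= cross_miss R e' chi j by apply: dens_ge0.
    by lra.
  rewrite /class_dens (dens_ext R none).
  by rewrite /dens; under eq_fun do rewrite /=; rewrite (averaging_const (avg_averaging R T0)).
have H4 i : cross_miss R e' chi i <= deficit chi S (chi i) by rewrite /deficit lerBrDl -own.
have H5 : dens R (fun i => ~~ Y i) <= q / 16%:R.
  rewrite -(ler_pM2r M0) -[X in _ * X%:R <= _](card_ord m.+2) (dens_card R T0).
  apply: (@le_trans _ _ 2%:R); last by have := m_large; lra.
  rewrite ler_nat -[leqRHS](size_iota 0 2) cardE -(size_map val).
  apply: uniq_leq_size; first by rewrite map_inj_uniq ?enum_uniq //; exact: val_inj.
  move=> k /mapP[i]; rewrite mem_enum => iY ->; rewrite mem_iota leq0n add0n.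
  by move: iY; rewrite unfold_in /Y -ltnNge.
have H6 : cross_miss R e' chi y <= deficit chi S (chi x) by rewrite -yx.
have key := common_clique_density T0 q0 H1 H2 H3 (fun i _ => H4 i) H5 yx (H4 x) H6.
have : 0 < (q / 4%:R) ^+ r by rewrite exprn_gt0 // divr_gt0.
move=> q_gt0; have E_gt0 := lt_le_trans q_gt0 key.
have [t [st _]] := averaging_witness (iavg_averaging r (avg_averaging R T0)) E_gt0.
rewrite ltr0n lt0b => /andP[ct Lt].
have [Q [z [tE LQ Pz]]] := all2_rcons_inv Lt.
exists Q, z; rewrite -tE; split=> //.
- by rewrite -st tE size_rcons.
- rewrite tE all_rcons; apply/andP; split; first by case/and3P: Pz.
  by apply: all2_all LQ => j w _ /and3P[].
- apply: all2_all LQ => j w; rewrite mem_filter => /andP[/negPf jc _].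
  by move=> /and3P[_ _]; rewrite jc => /andP[].
- apply: all2_all LQ => j w; rewrite mem_filter => /andP[/negPf jc _].
  by move=> /and3P[_ _]; rewrite jc => /andP[].
Qed.


Let lift z : 'I_m.+2 := inord (index z s0).+2.

Let liftK z : z \in s0 -> f (lift z) = z.
Proof.
move=> zs; rewrite /f /lift inordK; last by rewrite !ltnS -sm index_mem.
by rewrite /s /= nth_index.
Qed.

Let f_mem (i : 'I_m.+2) : (2 <= i)%N -> f i \in s0.
Proof.
case: i => [[|[|i]] lti] //= _; rewrite /f /s /=.
by apply: mem_nth; rewrite sm.
Qed.

Let liftP t : all (mem s0) t -> pairwise e t -> pairwise e' (map lift t).
Proof.
move=> ts; rewrite pairwise_map; apply: (sub_in_pairwise (P := mem s0)) ts => x y xs ys /=.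
by rewrite /e' !liftK.
Qed.

Let share_same_colour (chi : 'I_m.+2 -> 'I_r) i z : (forall x y, e' x y -> chi x != chi y) ->
  z \in s0 -> share s0 (f i) z -> chi i = chi (lift z).
Proof.
move=> chiP zs /existsP[Q /and4P[Qs cQ iQ zQ]].
apply: (common_clique_same_colour chiP (Q := map lift Q)).
- by rewrite size_map size_tuple.
- exact: liftP.
- apply/allP => _ /mapP[w wQ ->]; rewrite /e' liftK; first exact: (allP iQ).
  exact: (allP Qs).
- apply/allP => _ /mapP[w wQ ->]; rewrite /e' !liftK //; first exact: (allP zQ).
  exact: (allP Qs).
Qed.

Lemma good_sample_clique :
  exists zs, [/\ size zs = r, all (mem s0) zs & pairwise e zs].
Proof.
have [chi chiP] := colouring.
have [Q [z [sQ cQ Qge _ _]]] := common_cliques (x := ord0) (y := ord0) chiP erefl.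
exists (map f (rcons Q z)); rewrite size_map size_rcons sQ prednK //; split=> //.
  by apply/allP => _ /mapP[i iQ ->]; apply: f_mem; apply: (allP Qge).
by rewrite pairwise_map.
Qed.

(** The clique [zs] uses all [r] colours, so [u] has the colour of one of its members and shares a
    clique with it. Conversely sharing forces equal colours, so [u] and [v] sharing with the same
    member are coloured alike and are not adjacent. *)
Lemma good_sample_share zs :
  size zs = r -> all (mem s0) zs -> pairwise e zs ->
  [/\ exists2 i : 'I_r, true & share s0 u (nth u zs i),
      exists2 i : 'I_r, true & share s0 v (nth u zs i)
    & forall i : 'I_r, share s0 u (nth u zs i) -> share s0 v (nth u zs i) -> ~~ e u v].
Proof.
move=> sz zss cz; have [chi chiP] := colouring.
have zin (i : 'I_r) : nth u zs i \in s0 by apply: (allP zss); rewrite mem_nth ?sz.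
have sh (i : 'I_m.+2) : exists2 j : 'I_r, true & share s0 (f i) (nth u zs j).
  have : chi i \in map chi (map lift zs).
    apply: mem_uniq_full; last by rewrite !size_map.
    by apply: (clique_colours_uniq chiP); apply: liftP.
  rewrite -map_comp => /(nthP (chi i))[j]; rewrite size_map sz => ltj.
  rewrite (nth_map u) ?sz //= => cj; exists (Ordinal ltj) => //=.
  have [Q [w [sQ cQ Qge iQ zQ]]] := common_cliques chiP cj.
  have zj : nth u zs j \in s0 := zin (Ordinal ltj).
  move: cQ Qge; rewrite pairwise_rcons all_rcons => /andP[_ cQ] /andP[_ Qge].
  have sQ' : size (map f Q) == r.-1 by rewrite size_map sQ.
  apply/existsP; exists (Tuple sQ'); apply/and4P; split=> /=.
  - by apply/allP => _ /mapP[k kQ ->]; apply: f_mem; apply: (allP Qge).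
  - by rewrite pairwise_map.
  - by apply/allP => _ /mapP[k kQ ->]; apply: (allP iQ).
  - apply/allP => _ /mapP[k kQ ->]; have := allP zQ k kQ.
    by rewrite /e' liftK.
have f1 : f (inord 1) = v by rewrite /f inordK.
split; [exact: (sh ord0)|by have := sh (inord 1); rewrite f1|].
move=> i ui vi; apply/negP => uv.
have : e' ord0 (inord 1) by rewrite /e' f1.
move=> /chiP/eqP; apply.
rewrite (share_same_colour (i := ord0) chiP (zin i) ui).
by rewrite (share_same_colour (i := inord 1) chiP (zin i)) // f1.
Qed.

End Good.
End Sample.

(** Bernoulli's inequality gives [rho ^ k <= 1 / (k h)]. Taking [M = 2 k] squares this, which beats
    the linear factor [2 (2 k + 1) <= 6 k]; hence the [6] in [x]. *)
Lemma geometric_rate_small (R : realType) (rho delta : R) (N : nat) :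
  0 <= rho -> rho < 1 -> 0 < delta ->
  exists2 M, (N < M)%N & M.+1%:R * 2%:R * rho ^+ M <= delta.
Proof.
move=> rho0 rho1 delta0; pose h : R := 1 - rho.
have h0 : 0 < h by rewrite subr_gt0.
have bern k : rho ^+ k * (1 + k%:R * h) <= 1.
  elim: k => [|k IH]; first by rewrite expr0 mul0r addr0 mul1r.
  apply: le_trans IH; rewrite exprSr -mulrA ler_wpM2l ?exprn_ge0 // -natr1.
  have rhoE : rho = 1 - h by rewrite /h; ring.
  by rewrite rhoE; have : 0 <= k%:R :> R by []; move: (k%:R : R) => K; nra.
pose x := 6%:R / (h ^+ 2 * delta).
have x0 : 0 <= x by rewrite divr_ge0 // mulr_ge0 ?exprn_ge0 // ltW.
pose k := (N + Num.bound x).+1; exists (k + k)%N; first by rewrite /k; lia.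
have kx : x < k%:R.
  by apply: lt_le_trans (archi_boundP x0) _; rewrite ler_nat /k; lia.
have k1 : 1 <= k%:R :> R by rewrite ler1n.
have kh : 6%:R <= k%:R * h ^+ 2 * delta.
  move: kx; rewrite /x ltr_pdivrMr; last by rewrite mulr_gt0 ?exprn_gt0.
  by rewrite mulrA; apply: ltW.
rewrite exprD leNgt; apply/negP => big.
have p0 : 0 <= rho ^+ k by rewrite exprn_ge0.
have pk : rho ^+ k * (k%:R * h) <= 1 by have := bern k; lra.
have pk2 : (rho ^+ k * (k%:R * h)) ^+ 2 <= 1 by apply: exprn_ile1 => //; rewrite !mulr_ge0 // ltW.
move: big; rewrite -natr1 natrD; move: pk2 kh; rewrite !expr2.
move: (rho ^+ k) (k%:R : R) k1 p0 => p K K1 p0 pk2 kh big.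
have b1 : delta < 6%:R * K * (p * p).
  by apply: lt_le_trans big _; have := mulr_ge0 p0 p0; nra.
have : delta * (K * (h * h)) < 6%:R * K * (p * p) * (K * (h * h)).
  by rewrite ltr_pM2r // !mulr_gt0 //; lra.
lra.
Qed.

Theorem sampling_partition (R : realType) (r : nat) (q eps gamma1 : R) :
  (0 < r)%N -> q = (3%:R * r%:R - 1)^-1 -> 0 < eps -> eps <= q / 10%:R -> 0 < gamma1 ->
  exists2 gamma, 0 < gamma &
    forall (V : finType) (e : rel V), (0 < #|V|)%N -> symmetric e -> irreflexive e ->
    (forall x, dens R (fun y => ~~ e x y) <= 3%:R * q - eps) ->
    iavg (@avg R V) r.+1 (fun s => (pairwise e s)%:R) <= gamma ->
    exists chi : V -> 'I_r,
      avg (fun x => dens R (fun y => e x y && (chi x == chi y))) <= gamma1.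
Proof.
move=> r0 qE eps0 eps_le gamma0.
(* For [r = 1] the clique average is the edge density itself. The case is separate because
   [theta <= 1] below comes from [q <= 1 / 5]. *)
have [r1|r2] := leqP r 1.
  have -> : r = 1%N by lia.
  exists gamma1 => // V e V0 sym irr _ small; exists (fun=> ord0).
  apply: le_trans small; rewrite /=; apply: (averaging_le (avg_averaging R V0)) => x _.
  by apply: (averaging_le (avg_averaging R V0)) => y _; rewrite eqxx /= !andbT.
have q5 : q <= 1 / 5%:R.
  have : (2%:R <= r%:R :> R) by rewrite ler_nat.
  by rewrite qE => rR; rewrite ler_pdivlMr // mulrC ler_pdivrMr; lra.
have q0 : 0 < q by lra.
(* [theta] is the threshold of [bad_sample], while every vertex misses at most [theta - h]; so [h]
   is the margin of the Chernoff bound. *)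
pose h := eps / 2%:R; pose theta := 3%:R * q - eps / 2%:R.
have [h0 h1 t0 t1] : [/\ 0 < h, h <= 1 / 2%:R, 0 <= theta & theta <= 1].
  by rewrite /h /theta; split; lra.
have ht : h <= theta by rewrite /h /theta; lra.
have /andP[rho0 rho1] := chernoff_rate_bounds h0 h1 t0 t1 ht.
have g4 : 0 < gamma1 / 4%:R by rewrite divr_gt0.
have [[//|m] mN mM] := geometric_rate_small (Num.bound (32%:R / q)) rho0 rho1 g4.
have m_large : 32%:R <= m.+2%:R * q.
  rewrite -ler_pdivrMr //; apply: ltW; apply: lt_le_trans (archi_boundP _) _.
    by rewrite divr_ge0 // ltW.
  by rewrite ler_nat (leq_trans (ltnW mN)).
exists (gamma1 / 4%:R / 2%:R ^+ m.+2); first by rewrite divr_gt0 ?exprn_gt0.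
move=> V e V0 sym irr miss small.
pose E k := iavg (@avg R V) k; pose avV := avg_averaging R V0.
have avE k : averaging _ (E k) := iavg_averaging k avV.
pose bad (s : seq V) : R := (bad_sample r e q eps s)%:R.
have Ebad : E m.+2 bad <= gamma1 / 2%:R.
  have missh x : dens R (fun y => ~~ e x y) <= theta - h.
    by apply: le_trans (miss x) _; rewrite /theta /h; lra.
  have B1 := iavg_sum_prod_miss_weight V0 h0 h1 t0 t1 m.+1 ht missh.
  have B2 := iavg_nsubseq R V0 m.+2 r.+1 (pairwise e).
  have B3 := ler_wpM2l (exprn_ge0 m.+2 (ler0n R 2)) small.
  rewrite [leRHS]mulrC divfK ?expf_neq0 // ?pnatr_eq0 // in B3.
  suff : E m.+2 bad <= E m.+2 (fun s => \sum_(x <- s) \prod_(y <- s) miss_weight e h theta x y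
      + (nsubseq r.+1 (pairwise e) s)%:R).
    rewrite (averagingD (avE _)) => /le_trans; apply.
    apply: le_trans (lerD (le_trans B1 mM) (le_trans B2 B3)) _; lra.
  apply: (averaging_le (avE _)) => s _; rewrite /bad /bad_sample.
  have p0 x : 0 <= \prod_(y <- s) miss_weight e h theta x y.
    by apply: prodr_ge0 => y _; apply: miss_weight_ge0.
  have S0 : 0 <= \sum_(x <- s) \prod_(y <- s) miss_weight e h theta x y by apply: sumr_ge0.
  case: hasP => [[x xs xb]|_] /=.
    rewrite ler_wpDr // (big_rem x) //= ler_wpDr ?sumr_ge0 //.
    exact: prod_miss_weight.
  by rewrite ler_wpDl // ler_nat; case: nsubseq.
have EbadE : E m.+2 bad = E m (fun s0 => avg (fun u => avg (fun v => bad [:: u, v & s0]))).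
  by rewrite /E /= -iavg_avg_comm; congr avg; apply/funext => u; rewrite -iavg_avg_comm.
(* [averaging_witness] finds large values, hence the sign. One [s0] is fixed for which at most a
   share [gamma1] of the pairs [u], [v] is bad. *)
have [s0 [ss0 _] bad0] : exists2 s0, all_size (fun=> True) m s0 &
    - gamma1 < -1 * avg (fun u => avg (fun v => bad [:: u, v & s0])).
  by apply: (averaging_witness (avE m)); rewrite (averagingZ (avE m)) -EbadE; lra.
have {}bad0 : avg (fun u => avg (fun v => bad [:: u, v & s0])) <= gamma1 by lra.
case: r r0 qE r2 rho0 small @bad Ebad EbadE bad0 => // r _ qE r2 rho0 small bad Ebad EbadE bad0.
(* If every pair is bad, the share of bad pairs is 1, so any colouring meets the bound. *)
have [[[u0 v0] good0]|allbad] := pselect (exists p, ~~ bad_sample r.+1 e q eps [:: p.1, p.2 & s0]); last first.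
  exists (fun=> ord0); apply: le_trans bad0.
  apply: (averaging_le avV) => u _; apply: (averaging_le avV) => v _.
  rewrite ler_nat; case: (boolP (bad_sample _ _ _ _ _)) => [_|nb]; first by case: (_ && _).
  by case: allbad; exists (u, v).
have [zs [sz zss cz]] := good_sample_clique sym irr (ltn0Sn r) qE eps0 eps_le ss0 m_large good0.
(* For a good pair any admissible index will do: adjacent vertices never share with the same member
   of [zs]. The default [ord0] is met only in bad pairs, so every monochromatic edge is a bad
   pair. *)
pose cls w := odflt ord0 [pick i : 'I_r.+1 | share r.+1 e s0 w (nth u0 zs i)].
exists cls; apply: le_trans bad0.
apply: (averaging_le avV) => u _; apply: (averaging_le avV) => v _.
rewrite ler_nat /bad; case: (boolP (bad_sample _ _ _ _ _)) => [_|good]; first by case: (_ && _).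
have [] := good_sample_share sym irr (ltn0Sn r) qE eps0 eps_le ss0 m_large good sz zss cz.
have nthE (i : 'I_r.+1) : nth u zs i = nth u0 zs i by apply: set_nth_default; rewrite sz.
move=> [i _ ui] [j _ vj] disj.
case: (boolP (e u v)) => //= uv; case: eqP => // cuv.
have clsP w : (exists k : 'I_r.+1, share r.+1 e s0 w (nth u zs k)) ->
    share r.+1 e s0 w (nth u zs (cls w)).
  move=> [k wk]; rewrite nthE /cls; case: pickP => //= /(_ k).
  by rewrite -nthE wk.
have := disj (cls u) (clsP u (ex_intro _ i ui)).
by rewrite {1}cuv => /(_ (clsP v (ex_intro _ j vj)))/negP.
Qed.

(** * Embedding H *)


Lemma box_mkseq (T : eqType) (P : seq T -> bool) Ts (F : nat -> T) :
  box P Ts -> (forall k, (k < size Ts)%N -> F k \in nth [::] Ts k) ->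
  P (mkseq F (size Ts)).
Proof.
move=> bP FT; apply: (boxP (x0 := F 0%N)) bP _ _; first by rewrite size_mkseq.
by move=> k ltk; rewrite nth_mkseq // FT.
Qed.

Lemma head_mem (T : eqType) (x : T) (A : seq T) : (0 < size A)%N -> head x A \in A.
Proof. by case: A => // a A _; rewrite mem_head. Qed.

Lemma box_one (T : eqType) (P : seq T -> bool) Ts i x :
  box P Ts -> (forall A, A \in Ts -> (0 < size A)%N) ->
  (i < size Ts)%N -> x \in nth [::] Ts i ->
  exists s, [/\ P s, size s = size Ts & nth x s i = x].
Proof.
move=> bP ne lti xi; pose F k := if k == i then x else head x (nth [::] Ts k).
exists (mkseq F (size Ts)); rewrite size_mkseq nth_mkseq // /F eqxx; split=> //.
apply: box_mkseq bP _ => k ltk; case: eqP => [->//|_].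
by rewrite head_mem // ne // mem_nth.
Qed.

Lemma box_two (T : eqType) (P : seq T -> bool) Ts i j x y :
  box P Ts -> (forall A, A \in Ts -> (0 < size A)%N) -> i != j ->
  (i < size Ts)%N -> (j < size Ts)%N -> x \in nth [::] Ts i -> y \in nth [::] Ts j ->
  exists s, [/\ P s, size s = size Ts, nth x s i = x & nth x s j = y].
Proof.
move=> bP ne ij lti ltj xi yj.
pose F k := if k == i then x else if k == j then y else head x (nth [::] Ts k).
exists (mkseq F (size Ts)); rewrite size_mkseq !nth_mkseq // /F !eqxx eq_sym (negPf ij).
split=> //; apply: box_mkseq bP _ => k ltk.
case: eqP => [->//|_]; case: eqP => [->//|_]; by rewrite head_mem // ne // mem_nth.
Qed.

Lemma box_pairwise (T : eqType) (e : rel T) (P : seq T -> bool) Ts :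
  box P Ts -> (forall A, A \in Ts -> (0 < size A)%N) -> (forall s, P s -> pairwise e s) ->
  forall i j x y, (i < j)%N -> (j < size Ts)%N ->
    x \in nth [::] Ts i -> y \in nth [::] Ts j -> e x y.
Proof.
move=> bP ne Pe i j x y ij ltj xi yj.
have [s [/Pe cs ss si sj]] := box_two bP ne (negbT (ltn_eqF ij)) (ltn_trans ij ltj) ltj xi yj.
by have := pairwiseP x cs i j; rewrite !inE ss si sj; apply=> //; apply: ltn_trans ij ltj.
Qed.

(** Half of the density pays for lists with repetitions. The threshold depends only on [k], [t] and
    [g]. *)
Lemma box_uniq_large (R : realType) (k t : nat) (g : R) : 0 < g ->
  exists n0 : nat, forall V : finType, (n0 <= #|V|)%N -> forall P : seq V -> bool,
    g <= iavg (@avg R V) k (fun s => (P s)%:R) ->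
    g ^+ (t ^ k) / 2%:R <=
      iavg (iavg (@avg R V) t) k (fun Ts => (box P Ts && all uniq Ts)%:R).
Proof.
move=> g0; pose a : R := k%:R * (t ^ 2)%:R; pose b := g ^+ (t ^ k) / 2%:R.
have a0 : 0 <= a by rewrite mulr_ge0.
have b0 : 0 < b by rewrite divr_gt0 // exprn_gt0.
exists (Num.bound (a / b)).+1 => W nW P gP.
have W0 : (0 < #|W|)%N by apply: leq_ltn_trans nW.
apply: le_trans (box_uniq_density R W0 k t P).
have := lerXn2r (t ^ k) (ltW g0) (le_trans (ltW g0) gP) gP.
have : k%:R * ((t ^ 2)%:R / #|W|%:R) <= b.
  rewrite mulrA -/a ler_pdivrMr ?ltr0n // mulrC -ler_pdivrMr //.
  apply: le_trans (ltW (archi_boundP _)) _; first by rewrite divr_ge0 // ltW.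
  by rewrite ler_nat (leq_trans _ nW).
rewrite -/b; have : g ^+ (t ^ k) = b + b by rewrite /b; lra.
lra.
Qed.

Lemma all_size_mem (T : eqType) (D : T -> Prop) k s : all_size D k s ->
  size s = k /\ forall x, x \in s -> D x.
Proof.
move=> [ss Ds]; split=> // x; elim: s Ds {ss} => //= y s IH [Dy Ds].
by rewrite inE => /predU1P[->|/IH]; [|apply].
Qed.

Section Graphs.
Variables (V : finType) (G : sgraph V).

Lemma adj_sym : symmetric (adj G).
Proof. by move=> x y; rewrite /adj setUC. Qed.

Lemma adj_irr : irreflexive (adj G).
Proof.
move=> x; apply/negP => xx; have /forall_inP/(_ _ xx) := edgesP G.
by rewrite setUid cards1.
Qed.

Lemma containsP (U : finType) (H : sgraph U) (f : U -> V) : injective f ->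
  (forall x y, adj H x y -> adj G (f x) (f y)) -> contains G H.
Proof.
move=> injf homf; apply/existsP; exists (finfun f); apply/andP; split.
  by apply/injectiveP => x y; rewrite !ffunE => /injf.
by apply/forallP => x; apply/forallP => y; apply/implyP; rewrite !ffunE; apply: homf.
Qed.

(** The vertices in [S] are placed by [g], the others in the lists chosen by [cl]. Deleting the
    image of [g] costs a list at most [#|U|] entries, and the remaining [#|U|] leave a slot of its
    own, numbered by [enum_rank], for every vertex of [H]. *)
Lemma contains_blowup (U : finType) (H : sgraph U) (S : pred U) (g : U -> V)
    (cl : U -> nat) (Ts : seq (seq V)) :
  {in S &, injective g} ->
  {in S &, forall h h', adj H h h' -> adj G (g h) (g h')} ->
  (forall h, ~~ S h -> (cl h < size Ts)%N) ->
  (forall h h', ~~ S h -> ~~ S h' -> adj H h h' -> cl h != cl h') ->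
  (forall h h', S h -> ~~ S h' -> adj H h h' ->
     forall z, z \in nth [::] Ts (cl h') -> adj G (g h) z) ->
  (forall A, A \in Ts -> uniq A /\ (2 * #|U| <= size A)%N) ->
  (forall i j x y, (i < j)%N -> (j < size Ts)%N ->
     x \in nth [::] Ts i -> y \in nth [::] Ts j -> adj G x y) ->
  contains G H.
Proof.
move=> injg homg clT clH gT Tsz TT.
pose L := [seq g h | h <- enum S].
pose F i := [seq z <- nth [::] Ts i | z \notin L].
have FT i z : z \in F i -> z \in nth [::] Ts i by rewrite mem_filter => /andP[].
have szF h : ~~ S h -> (enum_rank h < size (F (cl h)))%N.
  move=> nSh; apply: leq_trans (ltn_ord _) _.
  have [uT sT] := Tsz _ (mem_nth [::] (clT h nSh)).
  have le : (count (mem L) (nth [::] Ts (cl h)) <= #|U|)%N.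
    apply: (@leq_trans (size L)); last by rewrite size_map -cardE max_card.
    rewrite -size_filter; apply: uniq_leq_size; first exact: filter_uniq.
    by move=> z; rewrite mem_filter => /andP[].
  have cE : count (fun z => z \notin L) (nth [::] Ts (cl h)) =
      (size (nth [::] Ts (cl h)) - count (mem L) (nth [::] Ts (cl h)))%N.
    by rewrite -(count_predC (mem L)) addKn.
  rewrite size_filter cE leq_subRL; first by apply: leq_trans sT; rewrite mul2n -addnn leq_add2r.
  by rewrite count_size.
have Funiq h : ~~ S h -> uniq (F (cl h)).
  by move=> nSh; rewrite filter_uniq //; have [] := Tsz _ (mem_nth [::] (clT h nSh)).
have TTn i j x y : i != j -> (i < size Ts)%N -> (j < size Ts)%N ->
    x \in nth [::] Ts i -> y \in nth [::] Ts j -> adj G x y.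
  case: (ltngtP i j) => // ij _ li lj xi yj; first exact: (TT _ _ _ _ ij lj xi yj).
  by rewrite adj_sym; apply: (TT _ _ _ _ ij li yj xi).
pose phi h := if S h then g h else nth (g h) (F (cl h)) (enum_rank h).
have phiS h : S h -> phi h = g h by rewrite /phi => ->.
have phiN h : ~~ S h -> phi h \in F (cl h).
  by move=> nSh; rewrite /phi (negPf nSh) mem_nth ?szF.
have phiSN h h' : S h -> ~~ S h' -> phi h != phi h'.
  move=> Sh /phiN; rewrite mem_filter (phiS h) // => /andP[+ _]; apply: contraNneq => <-.
  by apply: map_f; rewrite mem_enum.
apply: (@containsP U H phi) => [h h'|h h' hh'].
- case: (boolP (S h)) => Sh; case: (boolP (S h')) => Sh' eq.
  + by apply: injg => //; rewrite -(phiS h) // -(phiS h').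
  + by have := phiSN _ _ Sh Sh'; rewrite eq eqxx.
  + by have := phiSN _ _ Sh' Sh; rewrite eq eqxx.
  have [cE|cN] := eqVneq (cl h) (cl h').
    move: eq; rewrite /phi (negPf Sh) (negPf Sh') -cE.
    rewrite (set_nth_default (g h')) ?szF // => /eqP.
    rewrite nth_uniq ?szF // ?Funiq //; last by rewrite cE szF.
    by move=> /eqP/val_inj/enum_rank_inj.
  have := TTn _ _ _ _ cN (clT _ Sh) (clT _ Sh') (FT _ _ (phiN _ Sh)) (FT _ _ (phiN _ Sh')).
  by rewrite eq adj_irr.
- case: (boolP (S h)) => Sh; case: (boolP (S h')) => Sh'.
  + by rewrite !phiS //; apply: homg.
  + rewrite phiS //; exact: (gT _ _ Sh Sh' hh' _ (FT _ _ (phiN _ Sh'))).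
  + rewrite adj_sym (phiS h') //; rewrite /adj setUC -/(adj H h' h) in hh'.
    exact: (gT _ _ Sh' Sh hh' _ (FT _ _ (phiN _ Sh))).
  apply: (TTn _ _ _ _ (clH _ _ Sh Sh' hh') (clT _ Sh) (clT _ Sh')); exact/FT/phiN.
Qed.

Lemma family_free_edges (F : graph_family) :
  family_free G F -> (#|edges G| <= ex #|V| F)%N.
Proof.
move=> free; pose h : V -> 'I_#|V| := @enum_rank V.
have injh : injective h := @enum_rank_inj V.
have simp : simple_edges [set h @: (f : {set V}) | f in edges G].
  apply/forall_inP => _ /imsetP[f fG ->]; rewrite card_imset //.
  by have /forall_inP/(_ _ fG) := edgesP G.
pose G' := SGraph simp.
have -> : #|edges G| = #|edges G'| by rewrite card_imset //; apply: imset_inj.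
apply: (leq_bigmax_cond G'); apply: sub_all free => A; apply: contra => /existsP[f].
case/andP=> /injectiveP injf /forallP homf.
apply: (@containsP _ _ (fun x => enum_val (f x))).
  by move=> x y /enum_val_inj/injf.
move=> x y xy; have /forallP/(_ y)/implyP/(_ xy) := homf x.
rewrite /adj => /imsetP[e eG eE].
suff -> : [set enum_val (f x); enum_val (f y)] = e by [].
apply: (imset_inj injh); rewrite -eE imsetU !imset_set1 /h.
by rewrite !enum_valK.
Qed.

Lemma card_pairs (P : rel V) : #|[set p | P p.1 p.2]| = (\sum_x #|[set y | P x y]|)%N.
Proof.
rewrite -sum1_card; under [RHS]eq_bigr do rewrite -sum1_card.
rewrite pair_big_dep /=; apply: eq_bigl => -[x y].
by rewrite !inE.
Qed.

(** The square of an edge also contains its two diagonal pairs, hence 4 instead of 2. *)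
Lemma card_adj_pairs : (#|[set p | adj G p.1 p.2]| <= 4 * #|edges G|)%N.
Proof.
have -> : (4 * #|edges G| = \sum_(f in edges G) #|setX f f|)%N.
  rewrite mulnC -sum_nat_const; apply: eq_bigr => f fG; rewrite cardsX.
  by have /forall_inP/(_ _ fG)/eqP-> := edgesP G.
have sub : [set p | adj G p.1 p.2] \subset \bigcup_(f in edges G) setX f f.
  apply/subsetP => -[x y]; rewrite inE /= => xy; apply/bigcupP; exists [set x; y] => //.
  by rewrite !inE !eqxx orbT.
apply: leq_trans (subset_leq_card sub) _.
elim/big_rec2: _ => [|f A n _ le]; first by rewrite cards0.
by rewrite (leq_trans (leq_card_setU _ _).1) // leq_add2l.
Qed.

End Graphs.

(** * Members of the bichromatic family and copies of H *)

Section Target.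
Variables (U : finType) (H : sgraph U) (r : nat).
Hypothesis chiH : chromatic_number H = r.+1.

Lemma chromatic_colouring :
  exists2 c : U -> nat, forall h, (c h <= r)%N & forall h h', adj H h h' -> c h != c h'.
Proof.
have : colourable H r.+1 by rewrite -chiH /chromatic_number; case: ex_minnP.
move=> /existsP[c /forallP cP]; exists (fun h => c h : nat) => [h|h h' hh'].
  by rewrite -ltnS.
by have /forallP/(_ h')/implyP/(_ hh') := cP h.
Qed.

Section Host.
Variables (V : finType) (G : sgraph V) (Ts : seq (seq V)).
Hypothesis Tsz : forall A, A \in Ts -> uniq A /\ (2 * #|U| <= size A)%N.
Hypothesis TT : forall i j x y, (i < j)%N -> (j < size Ts)%N ->
     x \in nth [::] Ts i -> y \in nth [::] Ts j -> adj G x y.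

Lemma contains_complete (v0 : V) : size Ts = r.+1 -> contains G H.
Proof.
move=> sTs; have [c cr cH] := chromatic_colouring.
apply: (@contains_blowup _ _ _ _ pred0 (fun=> v0) c Ts) => //.
- by move=> h _; rewrite sTs ltnS.
- by move=> h h' _ _; apply: cH.
Qed.

End Host.

Definition star_edges n : {set {set 'I_n.+1}} :=
  [set [set ord0; i] | i in [set~ ord0]].

Lemma star_proof n : simple_edges (star_edges n).
Proof.
apply/forall_inP => _ /imsetP[i i0 ->]; rewrite cards2.
by move: i0; rewrite !inE [ord0 == i]eq_sym => ->.
Qed.

Definition star n : sgraph 'I_n.+1 := SGraph (star_proof n).

Lemma card_star n : #|edges (star n)| = n.
Proof.
rewrite card_in_imset ?cardsC1 ?card_ord // => i j; rewrite !inE => i0 j0 /setP/(_ i).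
by rewrite !inE (negPf i0) eqxx /= => /esym/eqP.
Qed.

Lemma adj_star n (i j : 'I_n.+1) : adj (star n) i j -> (i == ord0) || (j == ord0).
Proof.
move=> /imsetP[k _ /setP eq]; have := eq ord0; rewrite !inE eqxx /=.
by rewrite ![ord0 == _]eq_sym.
Qed.

Lemma biex_star n : (n <= biex n.+1 H)%N \/
  exists2 c : {ffun U -> 'I_(chromatic_number H)}, proper_colouring H c &
    contains (star n) (induced H (two_colour_set c)).
Proof.
case: (boolP (family_free (star n) (bichromatic_family H))) => [free|].
  by left; rewrite -[leqLHS](card_star n); apply: leq_bigmax_cond.
rewrite /family_free /bichromatic_family all_map => /allPn[c].
rewrite mem_enum inE /= negbK => cP cS; right; by exists c.
Qed.

(** The vertex of [H] at the centre of the star, if any, goes to [v]. Without it the first two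
    colours together are independent, and [(c h).-1] merges them into one list, so that [r] lists
    suffice. *)
Lemma contains_star_join (V : finType) (G : sgraph V) (v : V) (Ts : seq (seq V)) n
    (c : {ffun U -> 'I_(chromatic_number H)}) :
  proper_colouring H c -> contains (star n) (induced H (two_colour_set c)) ->
  size Ts = r -> (0 < r)%N ->
  (forall A, A \in Ts -> uniq A /\ (2 * #|U| <= size A)%N) ->
  (forall i j x y, (i < j)%N -> (j < size Ts)%N ->
     x \in nth [::] Ts i -> y \in nth [::] Ts j -> adj G x y) ->
  (forall A z, A \in Ts -> z \in A -> adj G v z) ->
  contains G H.
Proof.
move=> /forallP cP /existsP[f /andP[/injectiveP injf /forallP homf]] sTs r0 Tsz TT vT.
pose S h := [exists x, (val x == h) && (f x == ord0)].
have SP h h' : S h -> S h' -> h = h'.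
  move=> /existsP[x /andP[/eqP<- /eqP fx]] /existsP[y /andP[/eqP<- /eqP fy]].
  by rewrite (injf x y) // fx fy.
have cr h : (c h <= r)%N by rewrite -ltnS -[X in (_ < X)%N]chiH.
have cH h h' : adj H h h' -> c h != c h' by move=> hh'; have /forallP/(_ h')/implyP/(_ hh') := cP h.
have clT h : ((c h).-1 < size Ts)%N by rewrite sTs; case: (c h : nat) (cr h).
apply: (@contains_blowup _ _ _ _ S (fun=> v) (fun h => (c h).-1) Ts) => //.
- by move=> h h' Sh Sh' _; apply: SP.
- by move=> h h' Sh Sh' hh'; move: hh'; rewrite (SP _ _ Sh Sh') adj_irr.
- move=> h h' nSh nSh' hh'; apply/negP => /eqP eq; have := cH _ _ hh'.
  have [hS|hS] := boolP (h \in two_colour_set c); last first.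
    have [hS'|hS'] := boolP (h' \in two_colour_set c).
      by move: hS hS' eq; rewrite !inE -(inj_eq val_inj) /=; lia.
    by move: hS hS' eq; rewrite !inE -(inj_eq val_inj) /=; lia.
  have [hS'|hS'] := boolP (h' \in two_colour_set c); last first.
    by move: hS hS' eq; rewrite !inE -(inj_eq val_inj) /=; lia.
  have /forallP/(_ (exist _ h' hS'))/implyP := homf (exist _ h hS).
  rewrite {1}/adj inE imsetU !imset_set1 /= => /(_ hh')/adj_star/orP[] f0 _.
    by case/negP: nSh; apply/existsP; exists (exist _ h hS); rewrite f0 /= eqxx.
  by case/negP: nSh'; apply/existsP; exists (exist _ h' hS'); rewrite f0 /= eqxx.
- by move=> h h' _ _ _ z; apply: vT; apply: mem_nth.
Qed.

(* The non-isolated vertices of the two-coloured part of H are placed by [f];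
   its isolated vertices go to the last list, which need not be joined to them. *)
Lemma contains_bichromatic_join (V : finType) (G G' : sgraph V) (Ts : seq (seq V)) (v0 : V) :
  size Ts = r -> (0 < r)%N ->
  (forall A, A \in Ts -> uniq A /\ (2 * #|U| <= size A)%N) ->
  (forall i j x y, (i < j)%N -> (j < size Ts)%N ->
     x \in nth [::] Ts i -> y \in nth [::] Ts j -> adj G x y) ->
  (forall x y, adj G' x y -> adj G x y) ->
  (forall x y i z, adj G' x y -> (i < r.-1)%N -> z \in nth [::] Ts i -> adj G x z) ->
  ~~ family_free G' (bichromatic_family H) -> contains G H.
Proof.
move=> sTs r0 Tsz TT G'G G'T; rewrite /family_free /bichromatic_family all_map.
move=> /allPn[c]; rewrite mem_enum inE /= negbK => /forallP cP /existsP[f].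
case/andP=> /injectiveP injf /forallP homf.
pose SS := two_colour_set c.
pose S h := (h \in SS) && [exists h', (h' \in SS) && adj H h h'].
pose g h := oapp f v0 (insub h : option {x : U | x \in SS}).
have gE h (hS : h \in SS) : g h = f (exist _ h hS) by rewrite /g insubT.
have cr h : (c h <= r)%N by rewrite -ltnS -[X in (_ < X)%N]chiH.
have cH h h' : adj H h h' -> (c h : nat) != c h'.
  by move=> hh'; have /forallP/(_ h')/implyP/(_ hh') := cP h.
have homS h h' : h \in SS -> h' \in SS -> adj H h h' -> adj G' (g h) (g h').
  move=> hS hS' hh'; rewrite !gE.
  have /forallP/(_ (exist _ h' hS'))/implyP := homf (exist _ h hS); apply.
  by rewrite {1}/adj inE imsetU !imset_set1 /=.
have inS h h' : h \in SS -> h' \in SS -> adj H h h' -> S h.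
  by move=> hS hS' hh'; rewrite /S hS; apply/existsP; exists h'; rewrite hS'.
(* Colours from 2 to [r] fill the lists from 0 to [r - 2]; the list [r - 1] is kept for the isolated
   vertices of the two-coloured part. *)
pose cl h := if h \in SS then r.-1 else (c h).-2.
have SSE h : (h \in SS) = (c h < 2)%N by rewrite inE.
apply: (@contains_blowup _ _ _ _ S g cl Ts) => //.
- move=> h h' /andP[hS _] /andP[hS' _]; rewrite !gE => /injf.
  by move=> /(congr1 val).
- by move=> h h' /andP[hS _] /andP[hS' _] hh'; apply/G'G/homS.
- move=> h _; rewrite sTs /cl; case: ifP; first by rewrite prednK.
  by rewrite SSE; have := cr h; lia.
- move=> h h' nSh nSh' hh'; have hh'2 : adj H h' h by rewrite /adj setUC.
  have := cH _ _ hh'; have := cr h; have := cr h'; rewrite /cl.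
  case: ifP => hS; case: ifP => hS'.
  + by rewrite (inS _ _ hS hS' hh') in nSh.
  + by move: hS'; rewrite SSE => /negbT; lia.
  + by move: hS; rewrite SSE => /negbT; lia.
  + by move: hS hS'; rewrite !SSE => /negbT ? /negbT; lia.
- move=> h h' /andP[hS /existsP[k /andP[kS hk]]] nSh' hh' z.
  have hS' : h' \notin SS.
    apply: contra nSh' => hS'; apply: (inS h' h) => //; by rewrite /adj setUC.
  rewrite /cl (negPf hS'); apply: (G'T _ _ _ _ (homS _ _ hS kS hk)).
  by move: hS'; rewrite SSE; have := cr h'; lia.
Qed.

End Target.

(** * Counting monochromatic edges *)

Section MaxCut.
Variables (V : finType) (e : rel V) (r : nat).
Hypotheses (sym : symmetric e) (irr : irreflexive e).

Definition mono_pairs (chi : V -> 'I_r) : nat :=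
  #|[set p | e p.1 p.2 && (chi p.1 == chi p.2)]|.

Lemma max_cut_colouring : (0 < r)%N -> exists chi : V -> 'I_r,
  (forall chi', (mono_pairs chi <= mono_pairs chi')%N) /\
  forall x j, (#|[set y | (chi y == chi x) && e x y]| <= #|[set y | (chi y == j) && e x y]|)%N.
Proof.
move=> r0; pose chi0 : {ffun V -> 'I_r} := [ffun=> Ordinal r0].
have [chi _ min0] := @arg_minnP _ chi0 xpredT (fun chi : {ffun V -> 'I_r} => mono_pairs chi) isT.
have min (chi' : V -> 'I_r) : (mono_pairs chi <= mono_pairs chi')%N.
  have <- : mono_pairs (finfun chi') = mono_pairs chi'.
    by apply: eq_card => p; rewrite !inE !ffunE.
  exact: min0.
exists chi; split=> // x j.
pose N (f : V -> 'I_r) i := #|[set y | (f y == i) && e x y]|.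
pose K (f : V -> 'I_r) := (\sum_(z | z != x)
   #|[set y | e z y && (f z == f y)] :\ x|)%N.
(* Ordered pairs starting at [x], ending at [x], and avoiding [x]. The last kind, [K], survives a
   recolouring of [x], so minimality compares the two values of [N]. *)
have split_mono (f : V -> 'I_r) : mono_pairs f = (N f (f x) + N f (f x) + K f)%N.
  rewrite /mono_pairs (card_pairs (fun z y => e z y && (f z == f y))) (bigD1 x) //= -addnA.
  congr (_ + _)%N; first by apply: eq_card => y; rewrite !inE andbC eq_sym.
  under eq_bigr do rewrite (cardsD1 x).
  rewrite big_split /=; congr (_ + _)%N.
  rewrite /N -sum1_card big_mkcond [in RHS]big_mkcond /=; apply: eq_bigr => z _.
  rewrite !inE; case: eqVneq => [->|zx]; first by rewrite irr andbF.
  by rewrite sym andbC; case: (_ && _).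
pose chi' z := if z == x then j else chi z.
have := min chi'; rewrite !split_mono.
have -> : K chi' = K chi.
  apply: eq_bigr => z zx; apply: eq_card => y; rewrite !inE /chi' (negPf zx).
  by case: (eqVneq y x).
have -> : N chi' (chi' x) = N chi j.
  apply: eq_card => y; rewrite !inE /chi' eqxx.
  by case: (eqVneq y x) => [->|//]; rewrite irr !andbF.
by rewrite leq_add2r !addnn leq_double.
Qed.

End MaxCut.

(** A linear lower bound for the binomial, so that a bound on the mean size of a set bounds the mean
    number of its [t]-subsets. *)
Lemma leq_bin_addn n k : (0 < k)%N -> (n < 'C(n, k) + k)%N.
Proof.
case: k => // k _; elim: n k => [|n IH] k; first by rewrite addnS.
rewrite binS; have := IH k; case: (ltnP n k) => [nk|kn]; first by lia.
have : (0 < 'C(n, k))%N by rewrite bin_gt0.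
lia.
Qed.

(** * Vertices with many neighbours in their own class *)

Section Exceptional.
Variables (R : realType) (V : finType) (e : rel V) (r t M : nat) (kappa eta : R).
Hypothesis V0 : (0 < #|V|)%N.
Local Notation E := (iavg (@avg R V)).
Let avE k := iavg_averaging k (avg_averaging R V0).

(** A random sequence is an [r]-clique joined, on average, to at least [t] vertices of [W'], hence
    on average to at least one whole [t]-subset. With at most [M] vertices in [W'] there are at most
    [2 ^ M] such subsets, and one of them is frequent with a bound free of [#|V|]. *)
Lemma exceptional_common_cliques (W : {set V}) (d : V -> R) :
  (0 < t)%N -> 0 < kappa -> 0 < eta -> t%:R / kappa <= M%:R * eta ->
  (forall v, v \in W -> eta <= d v) ->
  (forall v, v \in W -> kappa * d v <=
     E r (fun s => (pairwise e s && all (e v) s)%:R)) ->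
  t%:R / kappa < \sum_(v in W) d v ->
  exists T : {set V}, #|T| = t /\
    (2%:R ^+ M.+1)^-1 <=
      E r (fun s => (pairwise e s && [forall v in T, all (e v) s])%:R).
Proof.
move=> t0 k0 eta0 tM dW dE big.
(* Any [M] vertices of [W] suffice, because each contributes at least [eta]. *)
have [W' [sW' cW' dW']] : exists W' : {set V},
    [/\ W' \subset W, (#|W'| <= M)%N & t%:R / kappa <= \sum_(v in W') d v].
  have [le|gt] := leqP #|W| M; first by exists W; split=> //; apply: ltW.
  have sub : [set x in take M (enum W)] \subset W.
    by apply/subsetP => x; rewrite inE => /mem_take; rewrite mem_enum.
  have cW : #|[set x in take M (enum W)]| = M.
    rewrite cardsE; have /card_uniqP -> : uniq (take M (enum W)) by rewrite take_uniq ?enum_uniq.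
    by rewrite size_takel // -cardE ltnW.
  exists [set x in take M (enum W)]; split=> //; first by rewrite cW.
  apply: le_trans tM _; rewrite -{1}cW mulr_natl -sumr_const; apply: ler_sum => v vW.
  by apply: dW; apply: (subsetP sub).
pose TT := [set T : {set V} | (T \subset W') && (#|T| == t)].
pose P (T : {set V}) s := pairwise e s && [forall v in T, all (e v) s].
suff : 1 <= \sum_(T in TT) E r (fun s => (P T s)%:R).
  move=> ge1; apply: contrapT => nT; move: ge1; apply/negP; rewrite -ltNge.
  apply: (@le_lt_trans _ _ (\sum_(T in TT) (2%:R ^+ M.+1)^-1)).
    apply: ler_sum => T; rewrite inE => /andP[_ /eqP cT].
    by apply: ltW; rewrite ltNge; apply/negP => le; apply: nT; exists T.
  rewrite sumr_const -[_ *+ _]mulr_natl ltr_pdivrMr ?exprn_gt0 // mul1r -natrX ltr_nat.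
  apply: (@leq_ltn_trans (2 ^ M)); last by rewrite ltn_exp2l.
  apply: (@leq_trans #|powerset W'|); last by rewrite card_powerset leq_exp2l.
  by apply: subset_leq_card; apply/subsetP => T; rewrite !inE => /andP[].
rewrite -(averaging_sum (avE r)).
pose w (s : seq V) : R := \sum_(v in W') (pairwise e s && all (e v) s)%:R.
apply: (@le_trans _ _ (E r (fun s => w s - (t%:R - 1)))).
  rewrite (averagingB (avE r)) (averaging_const (avE r)) (averaging_sum (avE r)).
  have : t%:R <= \sum_(v in W') kappa * d v by rewrite -mulr_sumr mulrC -ler_pdivrMr.
  move=> /le_trans/(_ (ler_sum _ (fun v vW => dE v (subsetP sW' v vW)))) h; lra.
apply: (averaging_le (avE r)) => s _; rewrite /w /P; case: (pairwise e s) => /=; last first.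
  rewrite !big1 // subr_le0 subr_ge0 ler1n //.
pose B := [set v in W' | all (e v) s].
have -> : \sum_(v in W') (all (e v) s)%:R = #|B|%:R :> R.
  rewrite -natr_sum -sum1_card big_mkcond [in RHS]big_mkcond /=; congr _%:R.
  by apply: eq_bigr => v _; rewrite inE; case: (v \in W'); case: all.
have -> : \sum_(T in TT) [forall v in T, all (e v) s]%:R = 'C(#|B|, t)%:R :> R.
  rewrite -cards_draws -natr_sum -sum1_card big_mkcond [in RHS]big_mkcond /=; congr _%:R.
  apply: eq_bigr => T _; rewrite !inE.
  have -> : (T \subset B) = (T \subset W') && [forall v in T, all (e v) s].
    apply/subsetP/andP => [TB|[/subsetP TW /forall_inP Ts] v vT].
      split; first by apply/subsetP => v /TB; rewrite inE => /andP[].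
      by apply/forall_inP => v /TB; rewrite inE => /andP[].
    by rewrite inE TW ?Ts.
  by case: (T \subset W'); case: (#|T| == t); case: [forall v in T, _].
have := leq_bin_addn #|B| t0; rewrite -(ltr_nat R) natrD.
have : #|B|%:R + 1 <= 'C(#|B|, t)%:R + t%:R :> R by rewrite natr1 -natrD ler_nat leq_bin_addn.
lra.
Qed.

End Exceptional.

(** * Edges inside a class between typical vertices *)

Section ClassPairs.
Variables (R : realType) (U V : finType) (H : sgraph U) (G : sgraph V) (r t : nat).
Variables (chi : V -> 'I_r) (Y : pred V) (c : 'I_r) (kappa : R).
Hypothesis V0 : (0 < #|V|)%N.
Hypothesis chiH : chromatic_number H = r.+1.
Hypothesis tU : (2 * #|U| < t)%N.
Hypothesis free : ~~ contains G H.
Local Notation e := (adj G).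
Local Notation E := (iavg (@avg R V)).
Let avT := iavg_averaging r (iavg_averaging t (avg_averaging R V0)).

Let L := rcons [seq j <- enum 'I_r | j != c] c.

Definition class_cliques x y s := pairwise e s && all2 (common_clique_set e chi Y x y) L s.

Let class_cliques_adj x y s i v0 : chi x = c -> class_cliques x y s ->
  size s = r -> (i < r.-1)%N -> e x (nth v0 s i) && e y (nth v0 s i).
Proof.
move=> xc /andP[_ Ls] ss ir; have [Q [z [sE LQ _]]] := all2_rcons_inv Ls.
have sQ : size Q = r.-1 by rewrite -ss sE size_rcons.
have QQ : all (fun w => e x w && e y w) Q.
  apply: all2_all LQ => j w; rewrite mem_filter => /andP[/negPf jc _].
  by move=> /and3P[_ _]; rewrite xc jc.
by rewrite sE nth_rcons sQ ir; apply: (allP QQ); rewrite mem_nth ?sQ.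
Qed.

(** With the class [c] fixed, the lists of a blow-up follow the same order of classes for all pairs,
    so one [Ts] can serve many of them. The constant 8 is 2 from the averaging times 4 from
    [card_adj_pairs]. *)
Lemma class_pairs_biex (A : {set V * V}) : 0 < kappa ->
  (forall p, p \in A -> e p.1 p.2 /\ chi p.1 = c) ->
  (forall p, p \in A -> kappa <=
     iavg (E t) r (fun Ts => (box (class_cliques p.1 p.2) Ts && all uniq Ts)%:R)) ->
  #|A|%:R * kappa <= 8%:R * (biex #|V| H)%:R.
Proof.
move=> k0 Ae AE; have [->|[p0 p0A]] := set_0Vmem A; first by rewrite cards0 mul0r mulr_ge0.
have r0 : (0 < r)%N by apply: leq_ltn_trans (ltn_ord c).
pose I p Ts := box (class_cliques p.1 p.2) Ts && all uniq Ts.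
have A0 : 0 < #|A|%:R :> R by rewrite ltr0n; apply/card_gt0P; exists p0.
(* Half of the mean is given away for the strict inequality that [averaging_witness] asks for. *)
have : #|A|%:R * kappa / 2%:R < iavg (E t) r (fun Ts => \sum_(p in A) (I p Ts)%:R).
  rewrite (averaging_sum avT); apply: (@lt_le_trans _ _ (#|A|%:R * kappa)).
    by have := mulr_gt0 A0 k0; lra.
  by rewrite mulr_natl -sumr_const; apply: ler_sum.
move=> lt; have [Ts /all_size_mem[sTs Tst]] := averaging_witness avT lt.
have {Tst} sT B : B \in Ts -> size B = t by move=> /Tst[].
pose A' := [set p in A | I p Ts].
have -> : \sum_(p in A) (I p Ts)%:R = #|A'|%:R :> R.
  rewrite -natr_sum -sum1_card big_mkcond [in RHS]big_mkcond /=; congr _%:R.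
  by apply: eq_bigr => p _; rewrite inE; case: (p \in A); case: (I p Ts).
move=> {}lt.
have [p1 p1A] : exists p1, p1 \in A'.
  apply/card_gt0P; rewrite -(ltr0n R); apply: le_lt_trans lt.
  by rewrite divr_ge0 // mulr_ge0 // ltW.
have simp : simple_edges [set [set p.1; p.2] | p in A'].
  apply/forall_inP => _ /imsetP[p pA ->]; rewrite cards2.
  move: pA; rewrite inE => /andP[/Ae[ep _] _]; case: (p.1 =P p.2) => // pp.
  by rewrite pp adj_irr in ep.
pose G' := SGraph simp.
have A'G' p : p \in A' -> adj G' p.1 p.2 by move=> pA; apply/imsetP; exists p.
have G'A' x y : adj G' x y -> ((x, y) \in A') || ((y, x) \in A').
  move=> /imsetP[p pA /setP eq]; have := eq x; have := eq y; have := eq p.1; have := eq p.2.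
  have [ep _] : e p.1 p.2 /\ chi p.1 = c by apply: Ae; move: pA; rewrite inE => /andP[].
  have pE : (p.1, p.2) \in A' by rewrite -surjective_pairing.
  have np : p.1 != p.2 by apply/eqP => pp; rewrite pp adj_irr in ep.
  rewrite !in_set2 !eqxx ?orbT /= => /orP[]/eqP q2 /orP[]/eqP q1 _ _.
  - by rewrite q1 q2 eqxx in np.
  - by rewrite -q1 -q2 pE ?orbT.
  - by rewrite -q1 -q2 pE ?orbT.
  - by rewrite q1 q2 eqxx in np.
have szT B : B \in Ts -> (0 < size B)%N by move=> /sT ->; apply: leq_ltn_trans tU.
have A'box p : p \in A' -> [/\ e p.1 p.2, chi p.1 = c, box (class_cliques p.1 p.2) Ts & all uniq Ts].
  by rewrite inE => /andP[/Ae[? ?] /andP[? ?]]; split.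
have TT : forall i j x y, (i < j)%N -> (j < size Ts)%N ->
    x \in nth [::] Ts i -> y \in nth [::] Ts j -> e x y.
  have [_ _ bp _] := A'box _ p1A.
  by apply: (box_pairwise bp szT) => s /andP[].
have uT B : B \in Ts -> uniq B /\ (2 * #|U| <= size B)%N.
  move=> BT; have [_ _ _ /allP uTs] := A'box _ p1A.
  by split; [apply: uTs|rewrite sT // ltnW].
have A'T p i z : p \in A' -> (i < r.-1)%N -> z \in nth [::] Ts i -> e p.1 z && e p.2 z.
  move=> pA ir zT; have [_ pc bp _] := A'box _ pA.
  have iT : (i < size Ts)%N by rewrite sTs (leq_trans ir) ?leq_pred.
  have [s [Ps ss <-]] := box_one bp szT iT zT.
  by apply: class_cliques_adj => //; rewrite ss sTs.
have ffree : family_free G' (bichromatic_family H).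
  apply: contraR free; apply: (contains_bichromatic_join chiH p1.1 sTs r0 uT TT).
    by move=> x y /G'A'/orP[] /A'box[ep _ _ _] //; rewrite adj_sym.
  move=> x y i z /G'A'/orP[] pA ir zT; first by have /andP[] := A'T _ _ _ pA ir zT.
  by have /andP[] := A'T _ _ _ pA ir zT.
have := family_free_edges ffree; rewrite -/(biex _ H) => le.
have : (#|A'| <= 4 * biex #|V| H)%N.
  apply: leq_trans (leq_mul (leqnn 4) le); apply: leq_trans (card_adj_pairs G').
  by apply: subset_leq_card; apply/subsetP => p pA; rewrite inE A'G'.
rewrite -(ler_nat R) natrM; lra.
Qed.

End ClassPairs.

Lemma box_witness (R : realType) (V : finType) (k t : nat) (g : R) (P : seq V -> bool) :
  (0 < #|V|)%N -> 0 < g ->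
  g <= iavg (iavg (@avg R V) t) k (fun Ts => (box P Ts && all uniq Ts)%:R) ->
  exists Ts, [/\ size Ts = k, forall A, A \in Ts -> uniq A /\ size A = t & box P Ts].
Proof.
move=> V0 g0 /(lt_le_trans g0) E0.
have [Ts /all_size_mem[sTs sT]] :=
  averaging_witness (iavg_averaging k (iavg_averaging t (avg_averaging R V0))) E0.
rewrite ltr0n lt0b => /andP[bP /allP uT]; exists Ts; split=> // A AT.
by split; [apply: uT|have [] := sT A AT].
Qed.

Lemma min_degree_le (V : finType) (G : sgraph V) x : (min_degree G <= degree G x)%N.
Proof.
rewrite /min_degree; elim: (index_enum V) (mem_index_enum x) => [//|y s IH].
rewrite inE big_cons => /predU1P[->|/IH le]; first exact: geq_minl.
exact: leq_trans (geq_minr _ _) le.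
Qed.

Section Counting.
Variables (R : realType) (V : finType).
Hypothesis V0 : (0 < #|V|)%N.

Lemma avg_dens_pairs (P : rel V) :
  avg (fun x => dens R (P x)) * #|V|%:R * #|V|%:R = #|[set p | P p.1 p.2]|%:R.
Proof.
rewrite {1}/avg divfK ?pnatr_eq0 -?lt0n // mulr_suml card_pairs natr_sum.
by apply: eq_bigr => x _; rewrite (dens_card R V0) -cardsE.
Qed.

Lemma mono_pairs_le r (e : rel V) (chi : V -> 'I_r) (Y : pred V) : symmetric e ->
  (mono_pairs e chi)%:R <=
    2%:R * (\sum_(x | ~~ Y x) nbr_dens R e chi x (chi x) * #|V|%:R) +
    \sum_c #|[set p | [&& e p.1 p.2, chi p.1 == c, chi p.2 == c, Y p.1 & Y p.2]]|%:R :> R.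
Proof.
move=> sym; pose W1 := [set p : V * V | [&& ~~ Y p.1, e p.1 p.2 & chi p.1 == chi p.2]].
pose A c := [set p : V * V | [&& e p.1 p.2, chi p.1 == c, chi p.2 == c, Y p.1 & Y p.2]].
pose swap (p : V * V) := (p.2, p.1).
have cW : \sum_(x | ~~ Y x) nbr_dens R e chi x (chi x) * #|V|%:R = #|W1|%:R.
  rewrite (card_pairs (fun x y => [&& ~~ Y x, e x y & chi x == chi y])) natr_sum.
  rewrite big_mkcond; apply: eq_bigr => x _; case: (Y x) => /=.
    by rewrite (eq_card (B := pred0)) ?card0 // => y; rewrite inE.
  rewrite (dens_card R V0); congr _%:R; apply: eq_card => y.
  by rewrite !inE unfold_in /= andbC eq_sym.
rewrite cW mulr_natl mulr2n -natr_sum -!natrD ler_nat.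
have sub : [set p | e p.1 p.2 && (chi p.1 == chi p.2)] \subset
    (W1 :|: swap @: W1) :|: \bigcup_c A c.
  apply/subsetP => -[x y]; rewrite !inE /= => /andP[exy cxy]; rewrite exy cxy.
  case: (boolP (Y x)) => //= Yx; case: (boolP (Y y)) => Yy.
    apply/orP; right; apply/bigcupP; exists (chi x) => //.
    by rewrite inE /= exy Yx Yy eqxx eq_sym cxy.
  apply/orP; left; apply/imsetP; exists (y, x) => //.
  by rewrite inE /= Yy sym exy eq_sym cxy.
apply: leq_trans (subset_leq_card sub) _; apply: leq_trans (leq_card_setU _ _).1 _.
apply: leq_add.
  apply: leq_trans (leq_card_setU _ _).1 _.
  by rewrite leq_add2l leq_imset_card.
elim/big_rec2: _ => [|c B n _ le]; first by rewrite cards0.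
by rewrite (leq_trans (leq_card_setU _ _).1) // leq_add2l.
Qed.

End Counting.

(** * Choice of the constants and assembly *)

Theorem theorem6 (R : realType) (r : nat) (U : finType) (H : sgraph U)
    (r_ge1 : (1 <= r)%N) (chiH : chromatic_number H = r.+1) :
  exists C : R, forall eps : R, 0 < eps ->
    exists n0 : nat,
      forall (n : nat) (V : finType) (G : sgraph V),
        (n0 <= n)%N -> #|V| = n ->
        (1 - 3 / (3 * r%:R - 1) + eps) * n%:R < (min_degree G)%:R ->
        ~~ contains G H ->
        exists D : {set {set V}},
          [/\ D \subset edges G,
              #|D|%:R <= C * (biex n H)%:R
            & partite r (delete_edges G D)].
Proof.
have r1 : 1 <= r%:R :> R by rewrite ler1n.
pose q : R := (3%:R * r%:R - 1)^-1.
have q0 : 0 < q by rewrite invr_gt0; lra.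
have rq : (3%:R * r%:R - 1) * q = 1 by rewrite /q divff // gt_eqF //; lra.
have q2 : q <= 1 / 2%:R by nra.
(* Lists of size [2 * #|U|] are enough for [contains_blowup]; the successor makes them visibly
   nonempty. *)
pose t := (2 * #|U|).+1.
(* Only [r] and [#|U|] enter these constants, which make up [C]. [kap3] is the density of the
   blow-ups that [kap4] provides. *)
pose kappa : R := (q / 16%:R) ^+ r; pose kap4 : R := (q / 4%:R) ^+ r.
have kappa0 : 0 < kappa by rewrite exprn_gt0 // divr_gt0.
have kap40 : 0 < kap4 by rewrite exprn_gt0 // divr_gt0.
pose kap3 : R := kap4 ^+ (t ^ r) / 2%:R.
have kap30 : 0 < kap3 by rewrite divr_gt0 // exprn_gt0.
(* The 4 is 2 for the two orders of a pair with an exceptional vertex times 2 from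
   [#|V| <= 2 * biex #|V| H]; the other term is [8 / kap3] for each of the [r] classes. *)
exists (4%:R * (t%:R / kappa) + r%:R * (8%:R / kap3)) => eps eps0.
(* A smaller [eps] only weakens the degree condition, so it may be capped. *)
pose e0 : R := Num.min eps (q / 10%:R).
have [e00 e0eps e0q] : [/\ 0 < e0, e0 <= eps & e0 <= q / 10%:R].
  by rewrite /e0 lt_min !ge_min !lexx orbT eps0 divr_gt0.
(* A vertex with [d x < eta] still has [cross_miss] within the deficit for [s = 3 q - e0 / 2]. By
   Markov's inequality a mean of [eta * tau] leaves at most [tau] of the vertices outside [Y], and
   [tau = eta / 2] is at most [d x / 2] for each of these. *)
pose eta := e0 / 2%:R; pose tau := eta / 2%:R.
have eta0 : 0 < eta by rewrite divr_gt0.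
have tau0 : 0 < tau by rewrite divr_gt0.
have [gamma gamma0 sampling] :=
  sampling_partition r_ge1 (erefl q) e00 e0q (mulr_gt0 eta0 tau0).
pose M := Num.bound (t%:R / kappa / eta).
have tM : t%:R / kappa <= M%:R * eta.
  rewrite -ler_pdivrMr //; apply: ltW; apply: archi_boundP.
  by rewrite !divr_ge0 // ltW.
have g20 : 0 < (2%:R ^+ M.+1)^-1 :> R by rewrite invr_gt0 exprn_gt0.
have [n1 box1] := box_uniq_large r.+1 t gamma0.
have [n2 box2] := box_uniq_large r t (mulr_gt0 kappa0 eta0).
have [n3 box3] := box_uniq_large r t kap40.
have [n4 box4] := box_uniq_large r t g20.
exists (n1 + n2 + n3 + n4 + 2)%N => n V G ltn cV deg free; subst n.
have [nn1 nn2 nn3 nn4 nn] :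
  [/\ n1 <= #|V|, n2 <= #|V|, n3 <= #|V|, n4 <= #|V| & 2 <= #|V|]%N.
  by move: (#|V|) ltn; clear => m ltm; split; lia.
have V0 : (0 < #|V|)%N by apply: leq_trans nn.
have [v0 _] : exists v0 : V, v0 \in V by apply/card_gt0P.
have n0 : 0 < #|V|%:R :> R by rewrite ltr0n.
pose e := adj G; have sym : symmetric e := adj_sym G; have irr : irreflexive e := adj_irr G.
have avV := avg_averaging R V0; have avE k := iavg_averaging k avV.
have half g k : 0 < g -> 0 < g ^+ k / 2%:R :> R by move=> g0; rewrite divr_gt0 // exprn_gt0.
have tU (Ts : seq (seq V)) : (forall A, A \in Ts -> uniq A /\ size A = t) ->
    forall A, A \in Ts -> uniq A /\ (2 * #|U| <= size A)%N.
  by move=> sT A /sT[uA ->]; split=> //; apply: leqnSn.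
have tne (Ts : seq (seq V)) : (forall A, A \in Ts -> uniq A /\ size A = t) ->
    forall A, A \in Ts -> (0 < size A)%N.
  by move=> sT A /sT[_ ->].
have miss x : dens R (fun y => ~~ e x y) <= 3%:R * q - e0.
  rewrite (densC R V0); suff : 1 - 3%:R * q + eps <= dens R (e x) by lra.
  rewrite -(ler_pM2r n0) (dens_card R V0) -cardsE; apply: ltW; apply: lt_le_trans deg _.
  by rewrite ler_nat min_degree_le.
have few : iavg (@avg R V) r.+1 (fun s => (pairwise e s)%:R) <= gamma.
  rewrite leNgt; apply/negP => /ltW many.
  have [Ts [sTs sT bT]] := box_witness V0 (half _ _ gamma0) (box1 V nn1 _ many).
  case/negP: free; apply: (contains_complete chiH (tU _ sT) _ v0 sTs).
  by apply: (box_pairwise bT (tne _ sT)).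
have [chi1 chi1P] := sampling V e V0 sym irr miss few.
have [chi [chi_min chi_cut]] := max_cut_colouring sym irr r_ge1.
pose d x := nbr_dens R e chi x (chi x).
have davg : avg d <= eta * tau.
  apply: le_trans chi1P; rewrite -(ler_pM2r n0) -(ler_pM2r n0) !avg_dens_pairs //.
  rewrite ler_nat; apply: leq_trans (chi_min chi1); rewrite leq_eqVlt; apply/orP; left.
  by apply/eqP; apply: eq_card => p; rewrite !inE andbC eq_sym.
have dmin x j : d x <= nbr_dens R e chi x j.
  rewrite -(ler_pM2r n0) !(dens_card R V0) ler_nat -[leqLHS]cardsE -[leqRHS]cardsE.
  exact: chi_cut.
pose Y x := d x < eta; pose s := 3%:R * q - e0 / 2%:R.
have Ydens : dens R (fun x => ~~ Y x) <= tau.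
  rewrite -(ler_pM2l eta0); apply: le_trans davg; rewrite -(averagingZ avV).
  apply: (averaging_le avV) => x _; case: (boolP (Y x)) => [_|nY] /=.
    by rewrite mulr0; apply: (dens_ge0 R V0).
  by rewrite mulr1 leNgt.
have own x : dens R (fun y => ~~ e x y) =
    class_dens R chi (chi x) - d x + cross_miss R e chi x.
  have -> : class_dens R chi (chi x) = dens R (fun y => (chi y == chi x) && ~~ e x y) + d x.
    by rewrite addrC; apply: (dens_split R V0).
  rewrite addrK (dens_split R V0 _ (fun y => chi y == chi x)).
  by congr (_ + _); apply: (dens_ext R) => y /=; rewrite andbC.
have H1 : 59%:R / 20%:R * q <= s by rewrite /s; lra.
have H2 : r%:R * s - 1 <= q.
  by rewrite /s; have := mulr_ge0 (ler0n R r) (ltW e00); lra.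
have Ymiss x : Y x -> cross_miss R e chi x <= deficit chi s (chi x).
  by rewrite /deficit /Y /eta /s; have := miss x; rewrite own; lra.
(* A class that meets [Y] is bounded through one of its typical vertices; any other class lies
   outside [Y] and has density at most [tau]. *)
have H3 i : class_dens R chi i <= s.
  case: (pickP (fun x => (chi x == i) && Y x)) => [x /andP[/eqP <- /Ymiss]|none].
    have : 0 <= cross_miss R e chi x by apply: (dens_ge0 R V0).
    by rewrite /deficit; lra.
  apply: (@le_trans _ _ tau); last by rewrite /tau /eta /s; lra.
  apply: le_trans Ydens; apply: (dens_le R V0) => x xi.
  by have := none x; rewrite xi /= => ->.
have H5 : dens R (fun x => ~~ Y x) <= q / 16%:R.
  by apply: le_trans Ydens _; rewrite /tau /eta; lra.
have Wclique x : ~~ Y x -> kappa * d x <=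
    iavg (@avg R V) r (fun s => (pairwise e s && all (e x) s)%:R).
  move=> nY; have dx : eta <= d x by rewrite leNgt.
  apply: (neighbourhood_clique_density V0 q0 H1 H2 H3 Ymiss H5 q2).
  - by apply: le_trans (miss x) _; rewrite /s; lra.
  - by move=> j; apply: dmin.
  - by apply: le_trans Ydens _; rewrite /tau -/(d x); lra.
have Wsum : \sum_(x | ~~ Y x) d x <= t%:R / kappa.
  rewrite leNgt; apply/negP => big.
  have [|||T [cT Tcl]] := @exceptional_common_cliques R V e r t M kappa eta V0
    [set x | ~~ Y x] d isT kappa0 eta0 tM.
  - by move=> x; rewrite inE /Y -leNgt.
  - by move=> x; rewrite inE; apply: Wclique.
  - by under eq_bigl do rewrite inE.
  have [Ts [sTs sT bT]] := box_witness V0 (half _ _ g20) (box4 V nn4 _ Tcl).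
  (* [T] serves as one more list: [enum T :: Ts] is a blown-up clique with [r + 1] parts. *)
  have sT' A : A \in enum T :: Ts -> uniq A /\ size A = t.
    rewrite inE => /predU1P[->|/sT //]; by rewrite enum_uniq -cardE.
  case/negP: free; apply: (@contains_complete _ H r chiH V G (enum T :: Ts) (tU _ sT') _ v0).
    move=> [|i] [|j] x y //= ij ltj; last by apply: (box_pairwise bT (tne _ sT)) => // u /andP[].
    rewrite mem_enum => xT yj.
    have [u [/andP[_ /forall_inP Tu] su yu]] := box_one bT (tne _ sT) ltj yj.
    by rewrite -yu; apply: (allP (Tu x xT)); rewrite mem_nth ?su.
  by rewrite /= sTs.
have Wbig x : ~~ Y x -> (#|V| <= 2 * biex #|V| H)%N.
  move=> nY; have [|[c cP cS]] := biex_star H #|V|.-1.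
    by rewrite prednK //; move: (biex _ H) => b; move: (#|V|) nn; clear => m m2; lia.
  have dx : kappa * eta <= kappa * d x by rewrite ler_pM2l // leNgt.
  have [Ts [sTs sT bT]] := box_witness V0 (half _ _ (mulr_gt0 kappa0 eta0))
    (box2 V nn2 _ (le_trans dx (Wclique x nY))).
  case/negP: free; apply: (contains_star_join chiH (v := x) cP cS sTs r_ge1 (tU _ sT)).
    by apply: (box_pairwise bT (tne _ sT)) => u /andP[].
  move=> A z /(nthP [::])[i ltT <-] zi.
  have [u [/andP[_ xu] su zu]] := box_one bT (tne _ sT) ltT zi.
  by rewrite -zu; apply: (allP xu); rewrite mem_nth ?su.
have pairs_le c : #|[set p | [&& e p.1 p.2, chi p.1 == c, chi p.2 == c, Y p.1 & Y p.2]]|%:R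
    <= 8%:R / kap3 * (biex #|V| H)%:R.
  rewrite mulrAC ler_pdivlMr //.
  apply: (class_pairs_biex (t := t) (Y := Y) (chi := chi) (c := c) V0 chiH (leqnn _) free kap30).
    by move=> p; rewrite inE => /and3P[ep /eqP pc _].
  move=> [x y]; rewrite inE /= => /and5P[exy /eqP xc /eqP yc Yx Yy].
  apply: box3 => //; rewrite /class_cliques -xc.
  have yx : chi y = chi x by rewrite xc yc.
  apply: (common_clique_density V0 q0 H1 H2 H3 Ymiss H5 yx (Ymiss x Yx)).
  by have := Ymiss y Yy; rewrite yx.
exists [set [set p.1; p.2] | p in [set p | e p.1 p.2 && (chi p.1 == chi p.2)]]; split.
- by apply/subsetP => _ /imsetP[p + ->]; rewrite inE => /andP[].
- apply: (@le_trans _ _ (mono_pairs e chi)%:R); first by rewrite ler_nat leq_imset_card.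
  apply: le_trans (mono_pairs_le R V0 chi Y sym) _; rewrite [leRHS]mulrDl; apply: lerD.
    rewrite -mulr_suml.
    (* One exceptional vertex already forces [biex] to be of order [#|V|], which pays for all of
       them; without any the sum is empty. *)
    case: (pickP (fun x => ~~ Y x)) => [x /Wbig le|none].
      have : #|V|%:R <= 2%:R * (biex #|V| H)%:R :> R by rewrite -natrM ler_nat.
      have tk : 0 <= t%:R / kappa by rewrite divr_ge0 // ltW.
      move=> /(ler_wpM2l tk) le1; have := ler_wpM2r (ltW n0) Wsum; lra.
    rewrite big_pred0 // mul0r mulr0 !mulr_ge0 ?ler0n ?invr_ge0 //; exact: ltW.
  have -> : r%:R * (8%:R / kap3) * (biex #|V| H)%:R =
      \sum_(c < r) 8%:R / kap3 * (biex #|V| H)%:R.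
    by rewrite sumr_const card_ord -[RHS]mulr_natl -[LHS]mulrA.
  by apply: ler_sum => c _; apply: pairs_le.
- apply/existsP; exists (finfun chi); apply/forallP => i; apply/forall_inP => x xi.
  apply/forall_inP => y yi; move: xi yi; rewrite !inE !ffunE => /eqP xi /eqP yi.
  apply/negP; rewrite /adj inE => /andP[/imsetP nD exy]; apply: nD.
  by exists (x, y) => //; rewrite inE /= /e /adj exy xi yi eqxx.
Qed.
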